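(* Let $\Lambda$ be a finite dimensional algebra over an algebraically closed field $\mathbb{K}$. Let $\tau\text{-}\mathsf{rigid}\,\Lambda$ be the set of isomorphism classes of basic $\tau$-rigid modules in $\mathsf{mod}\,\Lambda$, and let $\mathsf{f_L}2\text{-}\mathsf{tors}^{*}\Lambda$ be the set of $2$-fold torsion classes $\mathcal{C}$ of $\mathsf{mod}\,\Lambda$ such that the smallest torsion class $T_1(\mathcal{C})$ of $\mathsf{mod}\,\Lambda$ containing $\mathcal{C}$ is functorially finite and $\mathcal{C}$ satisfies condition $( * )$. Then the maps $$\tau\text{-}\mathsf{rigid}\,\Lambda \to \mathsf{f_L}2\text{-}\mathsf{tors}^{*}\Lambda,\quad U \mapsto \mathsf{cok}_1 U, \qquad\text{and}\qquad \mathsf{f_L}2\text{-}\mathsf{tors}^{*}\Lambda \to \tau\text{-}\mathsf{rigid}\,\Lambda,\quad \mathcal{C} \mapsto \Phi(\mathcal{C}),$$ are (well defined and) mutually inverse, where $\Phi(\mathcal{C})$ is the basic module such that $\mathsf{add}\,\Phi(\mathcal{C}) = \mathcal{C} \cap \mathsf{add}\,P(T_1(\mathcal{C}))$.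
   Context: $\mathsf{mod}\,\Lambda$ is the category of finitely generated right $\Lambda$-modules; all subcategories are full and closed under isomorphisms. $\tau$ is the Auslander-Reiten translation; $M$ is $\tau$-rigid if $\mathrm{Hom}_\Lambda(M,\tau M)=0$; $M$ is basic if it has no direct summand $N\oplus N$ with $N$ indecomposable. $\mathsf{add}\,M$ is the subcategory of finite direct sums of direct summands of $M$. $\mathsf{cok}_1 U$ is the subcategory of all $C\in\mathsf{mod}\,\Lambda$ admitting an exact sequence $U_1\to U_0\to C\to 0$ with $U_0,U_1\in\mathsf{add}\,U$. Let $\mathcal{E}$ be an extension-closed subcategory of an abelian category $\mathcal{A}$. A conflation in $\mathcal{E}$ is a short exact sequence $0\to A\to B\to C\to 0$ of $\mathcal{A}$ with $A,B,C\in\mathcal{E}$. A subcategory $\mathcal{S}\subset\mathcal{E}$ is a torsion class of $\mathcal{E}$ if for every conflation $0\to A\to B\to C\to0$ in $\mathcal{E}$: $A,C\in\mathcal{S}$ implies $B\in\mathcal{S}$, and $B\in\mathcal{S}$ implies $C\in\mathcal{S}$. A $2$-fold torsion class of $\mathcal{A}$ is a subcategory $\mathcal{C}$ that is a torsion class of some torsion class of $\mathcal{A}$. A subcategory $\mathcal{X}$ of $\mathsf{mod}\,\Lambda$ is functorially finite if every module has a left and a right $\mathcal{X}$-approximation. (A right $\mathcal{X}$-approximation of $M$ is a morphism $f\colon X\to M$ with $X\in\mathcal{X}$ through which every morphism from an object of $\mathcal{X}$ to $M$ factors; it is right minimal if every $g\in\mathrm{End}(X)$ with $fg=f$ is an isomorphism;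 left versions are dual.) For an extension-closed $\mathcal{X}\subset\mathsf{mod}\,\Lambda$, an object $P\in\mathcal{X}$ is an Ext-progenerator of $\mathcal{X}$ if $\mathrm{Ext}^1_\Lambda(P,X)=0$ for all $X\in\mathcal{X}$ and every $X\in\mathcal{X}$ admits a conflation $0\to T\to P'\to X\to0$ in $\mathcal{X}$ with $P'\in\mathsf{add}\,P$. Every functorially finite torsion class $\mathcal{T}$ of $\mathsf{mod}\,\Lambda$ has a basic Ext-progenerator, unique up to isomorphism, denoted $P(\mathcal{T})$. Condition $( * )$ for $\mathcal{C}$ (with $T_1(\mathcal{C})$ functorially finite): for every $C\in\mathcal{C}$ and the right minimal $(\mathsf{add}\,P(T_1(\mathcal{C})))$-approximation $f\colon P_C\to C$ of $C$, one has $P_C\in\mathcal{C}$. *)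

(* Defs.v *)
From HB Require Import structures.
From mathcomp Require Import all_boot all_order all_algebra all_field.
From mathcomp Require Import boolp classical_sets functions.

Set Implicit Arguments.
Unset Strict Implicit.
Unset Printing Implicit Defensive.

Import GRing.Theory.
Local Open Scope ring_scope.
Local Open Scope classical_set_scope.

Definition isomorphic (R : nzRingType) (M N : lmodType R) : Prop :=
  exists f : {linear M -> N}, bijective f.

Definition kernel (R : nzRingType) (M N : lmodType R) (f : {linear M -> N}) :
  set M := [set x | f x = 0].

Definition finitely_generated (R : nzRingType) (M : lmodType R) : Prop :=
  exists (n : nat) (g : 'I_n -> M),
    forall x : M, exists c : 'I_n -> R, x = \sum_i c i *: g i.

(* Right A-modules are left modules over the converse ring A^c: [a *: x] in an
   [lmodType A^c] stands for x a. *)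
Structure fgmod (K : closedFieldType) (A : falgType K) := FgMod {
  fgmod_sort :> lmodType A^c;
  fgmod_fg : finitely_generated fgmod_sort
}.

(* Hom_A(P, A) for a right module P: it is a left A-module by
   (b *: f) x = b * f x. The type (A^c)^o is A as a right module over itself,
   and A^o is A as a left module over itself. *)
Section RegularDual.
Variables (K : closedFieldType) (A : falgType K) (P : lmodType A^c).

Definition regdual_pred : {pred P -> A^o} :=
  [pred f : P -> A^o | `[< linear (f : P -> (A^c)^o) >]].

Lemma regdual_submod_closed : submod_closed regdual_pred.
Proof.
split.
  apply/asboolP => a x y.
  by change ((0 : A) = (0 : A) * (a : A) + (0 : A)); rewrite mul0r addr0.
move=> b f g /asboolP fl /asboolP gl; apply/asboolP => a x y.
have fE : (f (a *: x + y) : A) = (f x : A) * (a : A) + (f y : A) := fl a x y.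
have gE : (g (a *: x + y) : A) = (g x : A) * (a : A) + (g y : A) := gl a x y.
rewrite -[LHS]/((b : A) * (f (a *: x + y) : A) + (g (a *: x + y) : A)).
rewrite -[RHS]/(((b : A) * (f x : A) + (g x : A)) * (a : A)
                + ((b : A) * (f y : A) + (g y : A))).
by rewrite fE gE mulrDr mulrDl mulrA addrACA.
Qed.

HB.instance Definition _ :=
  GRing.isSubmodClosed.Build _ _ regdual_pred regdual_submod_closed.

Record regdual := RegDual {
  regdual_fun :> P -> A^o;
  regdualP : regdual_fun \in regdual_pred
}.

HB.instance Definition _ := [isSub for regdual_fun].
HB.instance Definition _ := [Choice of regdual by <:].
HB.instance Definition _ := [SubChoice_isSubLmodule of regdual by <:].

End RegularDual.

Lemma regdual_map_subproof (K : closedFieldType) (A : falgType K)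
    (P Q : lmodType A^c) (f : {linear P -> Q}) (g : regdual Q) :
  (fun x => g (f x)) \in @regdual_pred K A P.
Proof.
apply/asboolP => a x y; rewrite linearP.
by have /asboolP := regdualP g; apply.
Qed.

Definition regdual_map (K : closedFieldType) (A : falgType K)
    (P Q : lmodType A^c) (f : {linear P -> Q}) (g : regdual Q) : regdual P :=
  RegDual (regdual_map_subproof f g).

(* D(L) = Hom_K(L, K) for a left module L, with K acting on L through
   k |-> k%:A: it is a right A-module by (phi a) x = phi (a x). *)
Section KDual.
Variables (K : closedFieldType) (A : falgType K) (L : lmodType A).

Definition kdual_pred : {pred L -> K} :=
  [pred f : L -> K |
    `[< forall (k : K) (x y : L), f (k%:A *: x + y) = k * f x + f y >]].

Lemma kdual_zmod_closed : zmod_closed kdual_pred.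
Proof.
split.
  apply/asboolP => k x y.
  by change ((0 : K) = k * (0 : K) + (0 : K)); rewrite mulr0 addr0.
move=> f g /asboolP fl /asboolP gl; apply/asboolP => k x y.
rewrite -[LHS]/(f (k%:A *: x + y) - g (k%:A *: x + y)).
rewrite -[RHS]/(k * (f x - g x) + (f y - g y)).
by rewrite fl gl mulrBr opprD addrACA.
Qed.

HB.instance Definition _ :=
  GRing.isZmodClosed.Build _ kdual_pred kdual_zmod_closed.

Record kdual := KDual {
  kdual_fun :> L -> K;
  kdualP : kdual_fun \in kdual_pred
}.

HB.instance Definition _ := [isSub for kdual_fun].
HB.instance Definition _ := [Choice of kdual by <:].
HB.instance Definition _ := [SubChoice_isSubZmodule of kdual by <:].

Lemma kdual_act_subproof (a : A^c) (f : kdual) :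
  (fun x => f ((a : A) *: x)) \in kdual_pred.
Proof.
apply/asboolP => k x y; have /asboolP fl := kdualP f.
by rewrite scalerDr scalerA -scalerAr mulr1 -fl scalerA -scalerAl mul1r.
Qed.

Definition kdual_act (a : A^c) (f : kdual) : kdual :=
  KDual (kdual_act_subproof a f).

Lemma kdual_actA (a b : A^c) (f : kdual) :
  kdual_act a (kdual_act b f) = kdual_act (a * b) f.
Proof. by apply/val_inj/funext => x /=; rewrite scalerA. Qed.

Lemma kdual_act1 : left_id (1 : A^c) kdual_act.
Proof. by move=> f; apply/val_inj/funext => x /=; rewrite scale1r. Qed.

Lemma kdual_actDr : right_distributive kdual_act +%R.
Proof. by move=> a f g; apply/val_inj/funext. Qed.

Lemma kdual_actDl (f : kdual) : {morph kdual_act^~ f : a b / a + b}.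
Proof.
move=> a b; apply/val_inj/funext => x; have /asboolP fl := kdualP f.
rewrite -[LHS]/(f (((a : A) + (b : A)) *: x)).
rewrite -[RHS]/(f ((a : A) *: x) + f ((b : A) *: x)).
by have := fl 1 ((a : A) *: x) ((b : A) *: x);
  rewrite !scale1r mul1r scalerDl.
Qed.

HB.instance Definition _ := GRing.Zmodule_isLmodule.Build A^c kdual
  kdual_actA kdual_act1 kdual_actDr kdual_actDl.

End KDual.

Section ModuleCategory.
Variables (K : closedFieldType) (A : falgType K).
Implicit Types (M N P Q U V X Y Z : fgmod A).

(* A full subcategory of mod A. The constraints on the universe of [set] exclude
   [set (fgmod A)]. *)
Definition subcat := fgmod A -> Prop.

Implicit Types (C E S T : subcat).

Definition subcat_le S T : Prop := forall M, S M -> T M.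

Definition subcat_eq S T : Prop := forall M, S M <-> T M.

Definition modcat : subcat := fun=> True.

Lemma dsum_fg M N : finitely_generated (M * N)%type.
Proof.
case: (fgmod_fg M) => m [g gP]; case: (fgmod_fg N) => n [h hP].
exists (m + n)%N, (fun i => match fintype.split i with
  | inl j => (g j, 0) | inr j => (0, h j) end) => -[x y].
have [c ->] := gP x; have [d ->] := hP y.
exists (fun i => match fintype.split i with inl j => c j | inr j => d j end).
rewrite big_split_ord.
have sl (i : 'I_m) : fintype.split (lshift n i) = inl i := unsplitK (inl i).
have sr (i : 'I_n) : fintype.split (rshift m i) = inr i := unsplitK (inr i).
rewrite (eq_bigr (fun i => c i *: ((g i, 0) : M * N))); last first.
  by move=> i _; rewrite sl.
rewrite [X in _ = _ + X](eq_bigr (fun i => d i *: ((0, h i) : M * N))); last first.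
  by move=> i _; rewrite sr.
have H1 : \sum_i c i *: ((g i, 0) : M * N) = (\sum_i c i *: g i, 0).
  elim/big_rec2: _ => //= i u v _ ->.
  by congr pair; rewrite /= scaler0 addr0.
have H2 : \sum_i d i *: ((0, h i) : M * N) = (0, \sum_i d i *: h i).
  elim/big_rec2: _ => //= i u v _ ->.
  by congr pair; rewrite /= scaler0 addr0.
by rewrite H1 H2; congr pair; rewrite /= ?addr0 ?add0r.
Qed.

Definition dsum M N : fgmod A := FgMod (dsum_fg M N).

Definition zero_mod M : Prop := forall x : M, x = 0.

Definition isoclass M : subcat := fun N => isomorphic M N.

Definition iso_closed S : Prop := forall M N, isomorphic M N -> S M -> S N.

Definition short_exact M N P (i : {linear M -> N}) (p : {linear N -> P}) :
  Prop := [/\ injective i, range i = kernel p & range p = setT].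

Definition conflation E M N P (i : {linear M -> N}) (p : {linear N -> P}) :
  Prop := [/\ E M, E N, E P & short_exact i p].

Definition direct_summand N M : Prop := exists N', isomorphic M (dsum N N').

Definition indecomposable M : Prop :=
  ~ zero_mod M /\
  forall N N', isomorphic M (dsum N N') -> zero_mod N \/ zero_mod N'.

Definition basic M : Prop :=
  forall N, indecomposable N -> ~ direct_summand (dsum N N) M.

Inductive add M : subcat :=
| add_zero Z : zero_mod Z -> add M Z
| add_dsum N X Y :
    direct_summand N M -> add M X -> isomorphic Y (dsum N X) -> add M Y.

(* Yoneda's description: every extension of M by N splits. *)
Definition Ext1_zero M N : Prop :=
  forall X (i : {linear N -> X}) (p : {linear X -> M}),
    short_exact i p -> exists s : {linear M -> X}, cancel s p.

Definition Hom_zero M N : Prop :=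
  forall (f : {linear M -> N}) (x : M), f x = 0.

Definition projective P : Prop :=
  forall M N (g : {linear M -> N}) (f : {linear P -> N}),
    range g = setT -> exists h : {linear P -> M}, forall x, g (h x) = f x.

(* f : P -> M corestricts to a projective cover of the submodule S of M;
   the last clause says that the epimorphism P -> S is essential. *)
Definition projective_cover P M (f : {linear P -> M}) (S : set M) : Prop :=
  [/\ projective P, range f = S &
      forall N (g : {linear N -> P}),
        [set f (g x) | x in setT] = S -> range g = setT].

Definition minimal_projective_presentation M P1 P0
    (p1 : {linear P1 -> P0}) (p0 : {linear P0 -> M}) : Prop :=
  projective_cover p0 setT /\ projective_cover p1 (kernel p0).

(* The left module L is a transpose Tr M, i.e. a cokernel of
   Hom_A(p1, A) : Hom_A(P0, A) -> Hom_A(P1, A). *)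
Definition transpose M (L : lmodType A) : Prop :=
  exists P1 P0 (p1 : {linear P1 -> P0}) (p0 : {linear P0 -> M})
         (q : {linear regdual P1 -> L}),
    [/\ minimal_projective_presentation p1 p0,
        range (regdual_map p1) = kernel q & range q = setT].

(* N is isomorphic to tau M = D (Tr M), which exists and is unique up to
   isomorphism. *)
Definition AR_translate M N : Prop :=
  exists L : lmodType A, transpose M L /\ isomorphic N (kdual L).

Definition tau_rigid M : Prop :=
  exists N, AR_translate M N /\ Hom_zero M N.

Definition cok1 U : subcat := fun M =>
  exists U1 U0 (f : {linear U1 -> U0}) (g : {linear U0 -> M}),
    [/\ add U U1, add U U0, range f = kernel g & range g = setT].

Definition torsion_class_in E S : Prop :=
  [/\ iso_closed S, subcat_le S E &
      forall M N P (i : {linear M -> N}) (p : {linear N -> P}),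
        conflation E i p -> (S M -> S P -> S N) /\ (S N -> S P)].

Definition torsion_class S : Prop := torsion_class_in modcat S.

Definition two_fold_torsion_class C : Prop :=
  exists2 T, torsion_class T & torsion_class_in T C.

(* The intersection of all torsion classes of mod A containing C. *)
Definition T1 C : subcat :=
  fun M => forall T, torsion_class T -> subcat_le C T -> T M.

Definition right_approximation S X M (f : {linear X -> M}) : Prop :=
  S X /\ forall Y (g : {linear Y -> M}),
    S Y -> exists h : {linear Y -> X}, forall y, f (h y) = g y.

Definition left_approximation S M X (f : {linear M -> X}) : Prop :=
  S X /\ forall Y (g : {linear M -> Y}),
    S Y -> exists h : {linear X -> Y}, forall x, h (f x) = g x.

Definition right_minimal X M (f : {linear X -> M}) : Prop :=
  forall g : {linear X -> X}, (forall x, f (g x) = f x) -> bijective g.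

Definition functorially_finite S : Prop :=
  forall M,
    (exists X (f : {linear X -> M}), right_approximation S f) /\
    (exists X (f : {linear M -> X}), left_approximation S f).

Definition Ext_progenerator S P : Prop :=
  [/\ S P, forall X, S X -> Ext1_zero P X &
      forall X, S X -> exists Y P' (i : {linear Y -> P'}) (p : {linear P' -> X}),
        conflation S i p /\ add P P'].

(* P is (a representative of) P(S). *)
Definition basic_Ext_progenerator S P : Prop :=
  basic P /\ Ext_progenerator S P.

Definition condition_star C : Prop :=
  forall P, basic_Ext_progenerator (T1 C) P ->
  forall M X (f : {linear X -> M}),
    C M -> right_approximation (add P) f -> right_minimal f -> C X.

Definition fL2tors_star C : Prop :=
  [/\ two_fold_torsion_class C, functorially_finite (T1 C) &
      condition_star C].

(* Phi C as a set of modules; it is the isomorphism class of one module. *)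
Definition Phi C : subcat := fun V =>
  basic V /\
  exists2 P, basic_Ext_progenerator (T1 C) P &
    subcat_eq (add V) (fun M => C M /\ add P M).

End ModuleCategory.

(* Main.v *)
Require Import Defs.
From HB Require Import structures.
From mathcomp Require Import all_boot all_order all_algebra all_field.
From mathcomp Require Import boolp classical_sets functions.

(** [tau]-rigidity of [U] amounts to [Ext^1(U, Fac U) = 0], where [Fac U] is the
    class of quotients of objects of [add U]: for a minimal projective
    presentation [P1 -> P0 -> U], [Hom(X, tau U)] is dual to the cokernel of
    [Hom(P0, X) -> Hom(P1, X)]. For such a [U], [Fac U] is the smallest torsion
    class containing [cok1 U], and [cok1 U] consists of the cokernels of
    monomorphisms [L -> U0] with [L] in [Fac U] and [U0] in [add U]; a horseshoe
    argument makes it a torsion class of [Fac U]. If [M] is in [cok1 U] and in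
    [add P], where [P] is the Ext-progenerator of [Fac U], then
    [0 -> L -> U0 -> M -> 0] splits, so [U] is recovered as the intersection of
    [cok1 U] and [add P]. Conversely, given [C] with progenerator [P] of [T1 C]
    and [add U] the intersection of [C] and [add P], condition (star) yields for
    every [M] in [C] an epimorphism [U0 -> M] with [U0] in [add U] and kernel in
    [T1 C]. Hence [C] is contained in [Fac U], so [T1 C = Fac U], and both
    inclusions between [C] and [cok1 U] follow. *)

Import Defs.

Set Implicit Arguments.
Unset Strict Implicit.
Unset Printing Implicit Defensive.

Import GRing.Theory.
Local Open Scope ring_scope.
Local Open Scope classical_set_scope.

(** * Linear maps, submodules and quotients *)

Section LinearMaps.
Variable R : nzRingType.
Implicit Types L M N P Q X : lmodType R.

Definition mklin M N (f : M -> N) (fl : linear f) : {linear M -> N} :=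
  HB.pack f (GRing.isLinear.Build R M N *:%R f fl).

Lemma lcomp_subproof M N P (g : {linear N -> P}) (f : {linear M -> N}) :
  linear (fun x => g (f x)).
Proof. by move=> a x y; rewrite !linearP. Qed.
Definition lcomp M N P (g : {linear N -> P}) (f : {linear M -> N}) :=
  mklin (lcomp_subproof g f).

Lemma lid_subproof M : linear (fun x : M => x).
Proof. by []. Qed.
Definition lid M := mklin (@lid_subproof M).

Lemma lzero_subproof M N : linear (fun _ : M => 0 : N).
Proof. by move=> a x y; rewrite scaler0 addr0. Qed.
Definition lzero M N := mklin (@lzero_subproof M N).

Lemma ladd_subproof M N (f g : {linear M -> N}) : linear (fun x => f x + g x).
Proof. by move=> a x y; rewrite !linearP scalerDr addrACA. Qed.
Definition ladd M N (f g : {linear M -> N}) := mklin (ladd_subproof f g).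

Lemma lsub_subproof M N (f g : {linear M -> N}) : linear (fun x => f x - g x).
Proof.
by move=> a x y; rewrite (linearP f) (linearP g) scalerBr opprD addrACA.
Qed.
Definition lsub M N (f g : {linear M -> N}) := mklin (lsub_subproof f g).

Lemma lfst_subproof M N : linear (fun u : M * N => u.1).
Proof. by []. Qed.
Definition lfst M N : {linear (M * N)%type -> M} := mklin (@lfst_subproof M N).

Lemma lsnd_subproof M N : linear (fun u : M * N => u.2).
Proof. by []. Qed.
Definition lsnd M N : {linear (M * N)%type -> N} := mklin (@lsnd_subproof M N).

Lemma lpair_subproof X M N (f : {linear X -> M}) (g : {linear X -> N}) :
  linear (fun x => (f x, g x)).
Proof. by move=> a x y; rewrite !linearP. Qed.
Definition lpair X M N (f : {linear X -> M}) (g : {linear X -> N}) :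
  {linear X -> (M * N)%type} := mklin (lpair_subproof f g).

Lemma lcopair_subproof X M N (f : {linear M -> X}) (g : {linear N -> X}) :
  linear (fun u : M * N => f u.1 + g u.2).
Proof. by move=> a x y; rewrite !linearP scalerDr addrACA. Qed.
Definition lcopair X M N (f : {linear M -> X}) (g : {linear N -> X}) :
  {linear (M * N)%type -> X} := mklin (lcopair_subproof f g).

Definition linl M N : {linear M -> (M * N)%type} := lpair (lid M) (lzero M N).
Definition linr M N : {linear N -> (M * N)%type} := lpair (lzero N M) (lid N).

Definition surj M N (f : M -> N) := forall y, exists x, f x = y.

Lemma surjP M N (f : M -> N) : range f = setT <-> surj f.
Proof.
split=> [fT y|fs].
  have [x _ fx] : range f y by rewrite fT.
  by exists x.
by apply/seteqP; split=> // y _; have [x <-] := fs y; exists x.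
Qed.

Lemma inj_ker M N (f : {linear M -> N}) :
  (forall x, f x = 0 -> x = 0) -> injective f.
Proof.
move=> f0 x y fxy; apply/eqP; rewrite -subr_eq0; apply/eqP/f0.
by rewrite linearB fxy subrr.
Qed.

Lemma ker_inj M N (f : {linear M -> N}) x : injective f -> f x = 0 -> x = 0.
Proof. by move=> fi fx; apply: fi; rewrite fx linear0. Qed.

Lemma lift_inj M N X (i : {linear N -> M}) (f : {linear X -> M}) :
  injective i -> (forall x, exists y, i y = f x) ->
  exists g : {linear X -> N}, forall x, i (g x) = f x.
Proof.
move=> ii /choice[g gE].
have gl : linear g by move=> a x y; apply: ii; rewrite linearP !gE linearP.
by exists (mklin gl).
Qed.

Lemma desc_surj M N Q (p : {linear M -> Q}) (f : {linear M -> N}) :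
  surj p -> (forall x, p x = 0 -> f x = 0) ->
  exists g : {linear Q -> N}, forall x, g (p x) = f x.
Proof.
move=> /choice[s sE] pf.
have fs x : f (s (p x)) = f x.
  by apply/eqP; rewrite -subr_eq0 -linearB pf ?linearB ?sE ?subrr.
have gl : linear (fun y => f (s y)).
  move=> a x y; rewrite -linearP -[RHS]fs; congr (f (s _)).
  by rewrite linearP !sE.
by exists (mklin gl).
Qed.

Lemma lin_inv M N (f : {linear M -> N}) : injective f -> surj f ->
  exists g : {linear N -> M}, cancel f g /\ cancel g f.
Proof.
move=> fi fs; have [g gE] := @lift_inj _ _ _ f (lid N) fi fs.
by exists g; split => // x; apply: fi; rewrite gE.
Qed.

Lemma isomorphic_refl M : isomorphic M M.
Proof. by exists (lid M); exists id. Qed.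

Lemma bij_surj M N (f : M -> N) : bijective f -> surj f.
Proof. by case=> g _ gK y; exists (g y). Qed.

Lemma inj_surj_bij M N (f : {linear M -> N}) :
  injective f -> surj f -> bijective f.
Proof. by move=> fi fs; have [g [fK gK]] := lin_inv fi fs; exists g. Qed.

Lemma isomorphicP M N : isomorphic M N <->
  exists (f : {linear M -> N}) (g : {linear N -> M}), cancel f g /\ cancel g f.
Proof.
split=> [[f fb]|[f [g [fK gK]]]]; last by exists f, g.
have [g gP] := lin_inv (bij_inj fb) (bij_surj fb).
by exists f, g.
Qed.

Lemma isomorphic_sym M N : isomorphic M N -> isomorphic N M.
Proof.
by move=> /isomorphicP[f [g [fK gK]]]; apply/isomorphicP; exists g, f.
Qed.

Lemma isomorphic_trans M N P :
  isomorphic M N -> isomorphic N P -> isomorphic M P.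
Proof.
move=> [f fb] [g gb]; exists (lcomp g f); exact: (bij_comp gb fb).
Qed.

Definition submodule M (S : set M) :=
  S 0 /\ forall (a : R) x y, S x -> S y -> S (a *: x + y).

Lemma submodule_ker M N (f : {linear M -> N}) : submodule (kernel f).
Proof.
split=> [|a x y]; rewrite /kernel /= ?linear0 // linearP => -> ->.
by rewrite scaler0 addr0.
Qed.

Lemma submodule_range M N (f : {linear M -> N}) : submodule (range f).
Proof.
split=> [|a x y [u _ <-] [v _ <-]]; first by exists 0; rewrite ?linear0.
by exists (a *: u + v); rewrite ?linearP.
Qed.

Lemma submodule_image M N (f : {linear M -> N}) (S : set M) :
  submodule S -> submodule (f @` S).
Proof.
move=> [S0 SD]; split=> [|a x y [u Su <-] [v Sv <-]].
  by exists 0; rewrite ?linear0.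
by exists (a *: u + v); rewrite ?linearP //; apply: SD.
Qed.

Lemma submoduleD M (S : set M) x y : submodule S -> S x -> S y -> S (x + y).
Proof. by move=> [_ SD] Sx Sy; have := SD 1 x y Sx Sy; rewrite scale1r. Qed.

Lemma submoduleZ M (S : set M) (a : R) x : submodule S -> S x -> S (a *: x).
Proof. by move=> [S0 SD] Sx; have := SD a x 0 Sx S0; rewrite addr0. Qed.

End LinearMaps.

Section Subquotients.
Variables (R : nzRingType) (M : lmodType R) (S : set M) (Ssub : submodule S).

Definition subm_pred of submodule S : {pred M} := [pred x | `[< S x >]].

Lemma subm_pred_closed : submod_closed (subm_pred Ssub).
Proof.
split=> [|a x y /asboolP Sx /asboolP Sy]; apply/asboolP; first exact: Ssub.1.
exact: Ssub.2.
Qed.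

HB.instance Definition _ :=
  GRing.isSubmodClosed.Build R M (subm_pred Ssub) subm_pred_closed.

Record subm := Subm { subm_val :> M; subm_valP : subm_val \in subm_pred Ssub }.

HB.instance Definition _ := [isSub for subm_val].
HB.instance Definition _ := [Choice of subm by <:].
HB.instance Definition _ := [SubChoice_isSubLmodule of subm by <:].

Lemma sub_obj : exists (N : lmodType R) (i : {linear N -> M}),
  injective i /\ forall x, S x <-> exists y, i y = x.
Proof.
have il : linear subm_val by [].
exists subm, (mklin il); split=> [x y|x]; first exact: val_inj.
split=> [Sx|[[y /= Sy] <-]]; last by apply/asboolP.
have Px : x \in subm_pred Ssub by apply/asboolP.
by exists (Subm Px).
Qed.

Local Open Scope quotient_scope.

Definition quotm : Type := Quotient.quot (subm_pred Ssub).
HB.instance Definition _ := GRing.Zmodule.on quotm.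

Definition qpi (x : M) : quotm := \pi_(Quotient.quot (subm_pred Ssub)) x.
Definition qrepr (x : quotm) : M := repr (x : Quotient.quot (subm_pred Ssub)).

Lemma qreprK : cancel qrepr qpi. Proof. exact: reprK. Qed.

Lemma qpiE x y : qpi x = qpi y <-> S (x - y).
Proof.
split=> [/eqP|Sxy]; last apply/eqP.
  by rewrite -Quotient.idealrBE => /asboolP.
by rewrite -Quotient.idealrBE; apply/asboolP.
Qed.

Lemma qpiD x y : qpi (x + y) = qpi x + qpi y.
Proof. by rewrite /qpi !piE. Qed.

Definition quotm_scale (a : R) (x : quotm) : quotm := qpi (a *: qrepr x).

Lemma quotm_scaleE a x : quotm_scale a (qpi x) = qpi (a *: x).
Proof.
apply/qpiE; rewrite -scalerBr; apply: submoduleZ => //; apply/qpiE.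
by rewrite qreprK.
Qed.

Lemma quotm_scaleA a b x :
  quotm_scale a (quotm_scale b x) = quotm_scale (a * b) x.
Proof. by rewrite -[x]qreprK !quotm_scaleE scalerA. Qed.

Lemma quotm_scale1 : left_id 1 quotm_scale.
Proof. by move=> x; rewrite -[x]qreprK !quotm_scaleE scale1r. Qed.

Lemma quotm_scaleDr : right_distributive quotm_scale +%R.
Proof.
move=> a x y; rewrite -[x]qreprK -[y]qreprK -qpiD !quotm_scaleE -qpiD.
by rewrite scalerDr.
Qed.

Lemma quotm_scaleDl x : {morph quotm_scale^~ x : a b / a + b}.
Proof.
by move=> a b; rewrite -[x]qreprK !quotm_scaleE -qpiD scalerDl.
Qed.

HB.instance Definition _ := GRing.Zmodule_isLmodule.Build R quotm
  quotm_scaleA quotm_scale1 quotm_scaleDr quotm_scaleDl.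

Lemma quot_obj : exists (Q : lmodType R) (p : {linear M -> Q}),
  surj p /\ forall x, p x = 0 <-> S x.
Proof.
have pl : linear (qpi : M -> quotm).
  by move=> a x y; rewrite qpiD -quotm_scaleE.
exists quotm, (mklin pl); split=> x; first by exists (qrepr x); apply: qreprK.
have q0 : qpi 0 = 0 := linear0 (mklin pl).
by rewrite -[x in S x]subr0 -qpiE q0.
Qed.

End Subquotients.

(** * Dimension over the ground field *)

Lemma row_span (K : fieldType) n (S : set 'rV[K]_n) :
  S 0 -> (forall a u v, S u -> S v -> S (a *: u + v)) ->
  exists B : 'M[K]_n, forall v, S v <-> (v <= B)%MS.
Proof.
move=> S0 SD.
pose P r := `[< exists B : 'M[K]_n,
  \rank B = r /\ forall v : 'rV_n, (v <= B)%MS -> S v >].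
have P0 : exists r, P r.
  exists 0%N; apply/asboolP; exists 0; split; first by rewrite mxrank0.
  by move=> v; rewrite submx0 => /eqP->.
have Pn r : P r -> (r <= n)%N by move=> /asboolP[B [<- _]]; apply: rank_leq_row.
case: (ex_maxnP P0 Pn) => r /asboolP[B [rB BS]] rmax.
exists B => v; split=> [Sv|]; last exact: BS.
apply: contrapT => /negP vB.
have /rmax : P (\rank (B + v)%MS).
  apply/asboolP; exists (B + v)%MS; split => // w /sub_addsmxP[[u1 u2] /= ->].
  rewrite addrC [u2]mx11_scalar mul_scalar_mx; apply: SD => //.
  exact/BS/submxMl.
rewrite -rB leqNgt => /negP; apply; have : (B < B + v)%MS.
  by rewrite ltmxE addsmxSl addsmx_sub submx_refl.
by rewrite ltmxErank => /andP[].
Qed.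

Section KStructure.
Variables (K : closedFieldType) (A : falgType K).
Implicit Types (M N P Q X Y : fgmod A).

(* The action of [K] on a right module, through [k |-> k%:A]. *)
Definition ksc (M : lmodType A^c) (k : K) (x : M) : M :=
  ((k *: (1 : A) : A) : A^c) *: x.

Section KscTheory.
Variable M : lmodType A^c.
Implicit Types (x y : M) (k l : K).

Lemma kscA k l x : ksc k (ksc l x) = ksc (k * l) x.
Proof.
rewrite /ksc scalerA; congr (_ *: _).
rewrite -[LHS]/((l *: (1 : A)) * (k *: (1 : A))).
by rewrite -scalerAl mul1r scalerA mulrC.
Qed.

Lemma ksc1 x : ksc 1 x = x.
Proof. by rewrite /ksc scale1r -[X in X *: x]/(1 : A^c) scale1r. Qed.

Lemma kscDr k x y : ksc k (x + y) = ksc k x + ksc k y.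
Proof. by rewrite /ksc scalerDr. Qed.

Lemma kscDl k l x : ksc (k + l) x = ksc k x + ksc l x.
Proof. by rewrite /ksc -scalerDl; congr (_ *: _); rewrite scalerDl. Qed.

Lemma ksc_scale k (a : A^c) x : ksc k (a *: x) = a *: ksc k x.
Proof.
rewrite /ksc !scalerA; congr (_ *: _).
rewrite -[LHS]/((a : A) * (k *: (1 : A))) -[RHS]/((k *: (1 : A)) * (a : A)).
by rewrite -scalerAl -scalerAr mulr1 mul1r.
Qed.

Lemma ksc0 x : ksc 0 x = 0.
Proof. by rewrite /ksc scale0r -[X in X *: x]/(0 : A^c) scale0r. Qed.

Lemma kscN1 x : ksc (-1) x = - x.
Proof. by apply/eqP; rewrite -addr_eq0 -{2}[x]ksc1 -kscDl addNr ksc0. Qed.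

Lemma kscr0 k : ksc k 0 = 0 :> M.
Proof. by rewrite /ksc scaler0. Qed.

Lemma ksc_sum I (r : seq I) k (F : I -> M) :
  ksc k (\sum_(i <- r) F i) = \sum_(i <- r) ksc k (F i).
Proof. by rewrite /ksc scaler_sumr. Qed.

End KscTheory.

Lemma linear_ksc (M N : lmodType A^c) (f : {linear M -> N}) k x :
  f (ksc k x) = ksc k (f x).
Proof. by rewrite /ksc linearZ. Qed.

Definition klin (M : lmodType A^c) n (phi : M -> 'rV[K]_n) :=
  forall k x y, phi (ksc k x + y) = k *: phi x + phi y.

Lemma kspan M : exists n (g : 'I_n -> M),
  forall x, exists c : 'I_n -> K, x = \sum_i ksc (c i) (g i).
Proof.
case: (fgmod_fg M) => m [g gP].
pose b := vbasis {:A}; pose d := \dim {:A}.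
pose T : finType := ('I_m * 'I_d)%type.
exists #|T|, (fun u : 'I_#|T| =>
  ((b`_((enum_val u).2 : 'I_d) : A) : A^c) *: g ((enum_val u).1 : 'I_m)).
move=> x; have [c ->] := gP x.
exists (fun u : 'I_#|T| =>
  coord b ((enum_val u).2 : 'I_d) (c ((enum_val u).1 : 'I_m) : A)).
rewrite (reindex (@enum_rank T)) /=; last first.
  by exists enum_val => u _; rewrite ?enum_rankK ?enum_valK.
under [RHS]eq_bigr do rewrite enum_rankK.
rewrite -(pair_bigA _ (fun i j => ksc (coord b j (c i : A))
   (((b`_j : A) : A^c) *: g i))) /=.
apply: eq_bigr => i _.
transitivity (((\sum_j coord b j (c i : A) *: b`_j : A) : A^c) *: g i).
  congr (_ *: _); apply: coord_basis; [exact: vbasisP|exact: memvf].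
rewrite -[X in X *: _]/(\sum_j ((coord b j (c i : A) *: b`_j : A) : A^c)).
rewrite scaler_suml; apply: eq_bigr => j _.
rewrite /ksc scalerA; congr (_ *: _).
rewrite -[RHS]/((b`_j : A) * (coord b j (c i : A) *: (1 : A))).
by rewrite -scalerAr mulr1.
Qed.

Lemma coords_ex M : exists n (phi : M -> 'rV[K]_n) (psi : 'rV[K]_n -> M),
  [/\ klin phi, cancel phi psi & cancel psi phi].
Proof.
have [n [g gP]] := kspan M.
pose ev (v : 'rV[K]_n) := \sum_i ksc (v 0 i) (g i).
have evD k u v : ev (k *: u + v) = ksc k (ev u) + ev v.
  rewrite /ev ksc_sum -big_split; apply: eq_bigr => i _ /=.
  by rewrite kscA -kscDl !mxE.
have evB u v : ev (u - v) = ev u - ev v.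
  by rewrite [u - v]addrC -[- v]scaleN1r evD kscN1 addrC.
have ev0 : ev 0 = 0 by rewrite /ev big1 // => i _; rewrite mxE ksc0.
have /choice[s sE] (x : M) : exists v, ev v = x.
  have [c ->] := gP x; exists (\row_i c i).
  by apply: eq_bigr => i _; rewrite mxE.
have [] := @row_span K n [set v | ev v = 0].
- exact: ev0.
- move=> a u v eu ev'; change (ev (a *: u + v) = 0).
  by rewrite evD eu ev' kscr0; apply: addr0.
move=> B BP; pose C := col_base (cokermx B).
have CP (v : 'rV_n) : v *m C = 0 <-> ev v = 0.
  have vE : v *m cokermx B = v *m C *m row_base (cokermx B).
    by rewrite -mulmxA mulmx_base.
  split=> [vC|/BP]; first apply/BP.
    by rewrite submxE vE vC mul0mx.
  rewrite submxE vE => /eqP vC.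
  apply: (row_free_inj (row_base_free (cokermx B))).
  by rewrite vC mul0mx.
have Cs (u v : 'rV_n) : ev u = ev v -> u *m C = v *m C.
  move=> euv; apply/eqP; rewrite -subr_eq0 -mulmxBl; apply/eqP/CP.
  by rewrite evB euv subrr.
have /row_fullP[D DC] : row_full C := col_base_full _.
exists (\rank (cokermx B)), (fun x => s x *m C), (fun v => ev (v *m D)); split.
- move=> k x y; rewrite scalemxAl -mulmxDl; apply: Cs.
  by rewrite evD !sE.
- move=> x; rewrite -[RHS]sE; apply/eqP; rewrite -subr_eq0 -evB; apply/eqP/CP.
  by rewrite mulmxBl -!mulmxA DC mulmx1 subrr.
- move=> v; transitivity (v *m D *m C); first by apply: Cs; rewrite sE.
  by rewrite -mulmxA DC mulmx1.
Qed.

Definition cdim M : nat := projT1 (cid (coords_ex M)).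
Definition crd M : M -> 'rV[K]_(cdim M) :=
  projT1 (cid (projT2 (cid (coords_ex M)))).
Definition ucrd M : 'rV[K]_(cdim M) -> M :=
  projT1 (cid (projT2 (cid (projT2 (cid (coords_ex M)))))).

Lemma crdP M : [/\ klin (@crd M), cancel (@crd M) (@ucrd M)
                 & cancel (@ucrd M) (@crd M)].
Proof. by rewrite /crd /ucrd; case: (cid (projT2 (cid (projT2 _)))). Qed.

Lemma crd_klin M k (x y : M) : crd (ksc k x + y) = k *: crd x + crd y.
Proof. by have [-> _ _] := crdP M. Qed.

Lemma crdK M : cancel (@crd M) (@ucrd M).
Proof. by have [] := crdP M. Qed.

Lemma ucrdK M : cancel (@ucrd M) (@crd M).
Proof. by have [] := crdP M. Qed.

Lemma crd_inj M : injective (@crd M).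
Proof. exact: can_inj (@crdK M). Qed.

Lemma crd0 M : crd (0 : M) = 0.
Proof.
have := crd_klin (-1) (0 : M) 0.
by rewrite kscr0 addr0 scaleN1r addNr.
Qed.

Lemma crdZ M k (x : M) : crd (ksc k x) = k *: crd x.
Proof. by rewrite -[ksc k x]addr0 crd_klin crd0 addr0. Qed.

Lemma crdD M (x y : M) : crd (x + y) = crd x + crd y.
Proof. by rewrite -[x]ksc1 crd_klin scale1r ksc1. Qed.

Lemma crd_sum M I (r : seq I) (F : I -> M) :
  crd (\sum_(i <- r) F i) = \sum_(i <- r) crd (F i).
Proof. exact: (big_morph _ (@crdD M) (crd0 M)). Qed.

Lemma mxl_subproof M N (f : {linear M -> N}) :
  linear (fun u => crd (f (ucrd u))).
Proof.
move=> k u v; rewrite -crd_klin; congr (crd _).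
rewrite -linear_ksc -linearD; congr (f _); apply: crd_inj.
by rewrite crd_klin !ucrdK.
Qed.

Definition mxl M N (f : {linear M -> N}) : 'M[K]_(cdim M, cdim N) :=
  lin1_mx (mklin (mxl_subproof f)).

Lemma mxlE M N (f : {linear M -> N}) x : crd (f x) = crd x *m mxl f.
Proof. by rewrite mul_rV_lin1 /= crdK. Qed.

Lemma mxl_klin M N k (f g h : {linear M -> N}) :
  (forall x, h x = ksc k (f x) + g x) -> mxl h = k *: mxl f + mxl g.
Proof.
by move=> hE; apply/matrixP => i j; rewrite !mxE /= hE crd_klin !mxE.
Qed.

Lemma mxl_eq M N (f g : {linear M -> N}) :
  mxl f = mxl g -> forall x, f x = g x.
Proof. by move=> fg x; apply: crd_inj; rewrite !mxlE fg. Qed.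

Lemma inj_row_freeP M N (f : {linear M -> N}) :
  injective f <-> row_free (mxl f).
Proof.
split=> [fi|/row_free_inj fi x y fxy].
  apply: inj_row_free => v vf; rewrite -[v]ucrdK.
  rewrite [ucrd v](ker_inj fi) ?crd0 //; apply: crd_inj.
  by rewrite mxlE ucrdK vf crd0.
by apply/crd_inj/fi; rewrite -!mxlE fxy.
Qed.

Lemma surj_row_fullP M N (f : {linear M -> N}) : surj f <-> row_full (mxl f).
Proof.
split=> [fs|ff y].
  rewrite -sub1mx; apply/row_subP => i.
  have [x xE] := fs (ucrd (row i 1%:M)).
  by rewrite -[row i _]ucrdK -xE mxlE submxMl.
have /submxP[D DE] : (crd y <= mxl f)%MS by apply: submx_full.
by exists (ucrd D); apply: crd_inj; rewrite mxlE ucrdK.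
Qed.

Lemma inj_cdim M N (f : {linear M -> N}) : injective f -> (cdim M <= cdim N)%N.
Proof. by move=> /inj_row_freeP/eqP <-; apply: rank_leq_col. Qed.

Lemma surj_cdim M N (f : {linear M -> N}) : surj f -> (cdim N <= cdim M)%N.
Proof. by move=> /surj_row_fullP/eqP <-; apply: rank_leq_row. Qed.

Lemma inj_cdim_surj M N (f : {linear M -> N}) :
  injective f -> (cdim N <= cdim M)%N -> surj f.
Proof.
move=> /[dup]/inj_cdim dMN /inj_row_freeP/eqP fr dNM; apply/surj_row_fullP.
by rewrite /row_full fr eqn_leq dMN dNM.
Qed.

Lemma surj_cdim_inj M N (f : {linear M -> N}) :
  surj f -> (cdim M <= cdim N)%N -> injective f.
Proof.
move=> /[dup]/surj_cdim dMN /surj_row_fullP/eqP fr dNM; apply/inj_row_freeP.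
by rewrite /row_free fr eqn_leq dMN dNM.
Qed.

Lemma surj_finitely_generated (R : nzRingType) (X Y : lmodType R)
    (f : {linear X -> Y}) :
  surj f -> finitely_generated X -> finitely_generated Y.
Proof.
move=> fs [n [g gP]]; exists n, (fun i => f (g i)) => y.
have [x <-] := fs y; have [c ->] := gP x; exists c.
by rewrite linear_sum; apply: eq_bigr => i _; rewrite linearZ.
Qed.

Lemma fgsub_obj M (S : set M) : submodule S ->
  exists (N : fgmod A) (i : {linear N -> M}),
  injective i /\ forall x, S x <-> exists y, i y = x.
Proof.
move=> Ss; have [N [i [ii iS]]] := sub_obj Ss.
have [] := @row_span K (cdim M) [set v | S (ucrd v)].
- by rewrite /= -(crd0 M) crdK; case: Ss.
- move=> a u v Su Sv; rewrite /= -[u]ucrdK -[v]ucrdK -crd_klin crdK.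
  by apply: submoduleD => //; apply: submoduleZ.
move=> B BP.
have /choice[g gE] (j : 'I_(cdim M)) : exists y, i y = ucrd (row j B).
  by apply/iS/BP/row_sub.
suff Nfg : finitely_generated N by exists (FgMod Nfg), i.
exists (cdim M), g => x.
have /BP/submxP[D DE] : [set v | S (ucrd v)] (crd (i x)).
  by rewrite /= crdK; apply/iS; exists x.
exists (fun j => (D 0 j *: (1 : A) : A)).
apply: ii; apply: crd_inj; rewrite DE linear_sum crd_sum mulmx_sum_row.
apply: eq_bigr => j _; rewrite -[X in i X]/(ksc (D 0 j) (g j)) linear_ksc.
by rewrite crdZ gE ucrdK.
Qed.

Lemma fgquot_obj M (S : set M) : submodule S ->
  exists (Q : fgmod A) (p : {linear M -> Q}),
  surj p /\ forall x, p x = 0 <-> S x.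
Proof.
move=> Ss; have [Q [p [ps pS]]] := quot_obj Ss.
by exists (FgMod (surj_finitely_generated ps (fgmod_fg M))), p.
Qed.

Lemma image_obj M N (f : {linear M -> N}) :
  exists (I : fgmod A) (e : {linear M -> I}) (i : {linear I -> N}),
  [/\ surj e, injective i & forall x, i (e x) = f x].
Proof.
have [I [i [ii iE]]] := fgsub_obj (submodule_range f).
have [x|e eE] := @lift_inj _ _ _ _ i f ii; first by apply/iE; exists x.
exists I, e, i; split => // y.
have /iE[x _ xE] : exists z, i z = i y by exists y.
by exists x; apply: ii; rewrite eE.
Qed.

Lemma ker_obj M N (f : {linear M -> N}) :
  exists (L : fgmod A) (i : {linear L -> M}),
  injective i /\ forall x, f x = 0 <-> exists y, i y = x.
Proof. exact: fgsub_obj (submodule_ker f). Qed.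

Lemma lksc_subproof (M N : lmodType A^c) k (f : {linear M -> N}) :
  linear (fun x => ksc k (f x)).
Proof. by move=> a x y; rewrite linearP kscDr ksc_scale. Qed.
Definition lksc (M N : lmodType A^c) k (f : {linear M -> N}) :=
  mklin (lksc_subproof k f).

Lemma lsum_subproof (M N : lmodType A^c) n (c : 'I_n -> K)
  (h : 'I_n -> {linear M -> N}) : linear (fun x => \sum_i ksc (c i) (h i x)).
Proof.
move=> a x y; rewrite scaler_sumr -big_split; apply: eq_bigr => i _ /=.
by rewrite linearP kscDr ksc_scale.
Qed.
Definition lsum (M N : lmodType A^c) n (c : 'I_n -> K)
  (h : 'I_n -> {linear M -> N}) := mklin (lsum_subproof c h).

Section HomSpace.
Variables M N : fgmod A.
Variable I : {linear M -> N} -> Prop.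
Hypothesis I0 : forall h : {linear M -> N}, (forall x, h x = 0) -> I h.
Hypothesis ID : forall k (f g h : {linear M -> N}), I f -> I g ->
  (forall x, h x = ksc k (f x) + g x) -> I h.

Lemma hom_row_span : exists B : 'M[K]_(cdim M * cdim N),
  forall v, (exists2 f, I f & mxvec (mxl f) = v) <-> (v <= B)%MS.
Proof.
apply: (@row_span K _ [set v | exists2 f, I f & mxvec (mxl f) = v]).
  have l0 : mxl (lzero M N) = 0.
    by apply/matrixP => i j; rewrite !mxE /= crd0 !mxE.
  by exists (lzero M N); [exact: I0|rewrite l0 linear0].
move=> a u v [f If <-] [g Ig <-].
have hE : forall x, ladd (lksc a f) g x = ksc a (f x) + g x by [].
exists (ladd (lksc a f) g); first exact: ID hE.
by rewrite (mxl_klin hE) linearP.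
Qed.

Lemma hom_span : exists n (h : 'I_n -> {linear M -> N}),
  (forall i, I (h i)) /\
  forall f, I f -> exists c, forall x, f x = \sum_i ksc (c i) (h i x).
Proof.
have [B BP] := hom_row_span.
have /choice[h hP] i : exists f, I f /\ mxvec (mxl f) = row i B.
  by have /BP[f ? ?] := row_sub i B; exists f.
exists _, h; split=> [i|f If]; first by case: (hP i).
have /submxP[D DE] : (mxvec (mxl f) <= B)%MS by apply/BP; exists f.
exists (D 0) => x; apply: crd_inj; rewrite mxlE crd_sum.
have -> : mxl f = \sum_i D 0 i *: mxl (h i).
  apply: (can_inj mxvecK); rewrite DE mulmx_sum_row linear_sum.
  by apply: eq_bigr => i _; rewrite linearZ /=; case: (hP i) => _ ->.
rewrite mulmx_sumr; apply: eq_bigr => i _.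
by rewrite crdZ mxlE scalemxAr.
Qed.

Lemma hom_separate (g : {linear M -> N}) : ~ I g ->
  exists lam : {linear M -> N} -> K,
  [/\ forall k (f f' h : {linear M -> N}),
        (forall x, h x = ksc k (f x) + f' x) -> lam h = k * lam f + lam f',
      forall f, I f -> lam f = 0 & lam g <> 0].
Proof.
move=> Ig; have [B BP] := hom_row_span.
have gB : mxvec (mxl g) *m cokermx B != 0.
  rewrite -submxE; apply/negP => /BP[f If /(can_inj mxvecK) fg].
  apply: Ig; apply: (@ID 0 f f g If If) => x.
  by rewrite ksc0 add0r (mxl_eq fg).
have /matrix0Pn[i [j ij]] := gB.
exists (fun f => (mxvec (mxl f) *m cokermx B) i j); split.
- move=> k f f' h /mxl_klin ->.
  by rewrite linearP /= mulmxDl -scalemxAl !mxE.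
- move=> f If; have : (mxvec (mxl f) <= B)%MS by apply/BP; exists f.
  by rewrite submxE => /eqP ->; rewrite mxE.
- exact/eqP.
Qed.

End HomSpace.
End KStructure.

(** * Fitting's lemma and the Krull-Schmidt theorem *)

Section KrullSchmidt.
Variables (K : closedFieldType) (A : falgType K).
Implicit Types (I M N P Q U V W X Y Z : fgmod A) (l m : seq (fgmod A)).
Implicit Types S : subcat A.

Arguments fgmod_sort : simpl never.
Arguments dsum : simpl never.

Definition retract N M := exists (i : {linear N -> M}) (p : {linear M -> N}),
  cancel i p.

Lemma retract_refl M : retract M M.
Proof. by exists (lid M), (lid M). Qed.

Lemma retract_trans M N P : retract M N -> retract N P -> retract M P.
Proof.
move=> [i [p ip]] [j [q jq]]; exists (lcomp j i), (lcomp p q) => x /=.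
by rewrite jq ip.
Qed.

Lemma iso_retract M N : isomorphic M N -> retract M N.
Proof. by move=> /isomorphicP[f [g [fK gK]]]; exists f, g. Qed.

Lemma iso_retract_sym M N : isomorphic M N -> retract N M.
Proof. by move=> /isomorphic_sym/iso_retract. Qed.

Lemma retract_dsuml M N : retract M (dsum M N).
Proof. by exists (linl M N), (lfst M N). Qed.

Lemma retract_dsumr M N : retract N (dsum M N).
Proof. by exists (linr M N), (lsnd M N). Qed.

Lemma retract_dsum M M' N N' :
  retract M M' -> retract N N' -> retract (dsum M N) (dsum M' N').
Proof.
move=> [i [p ip]] [j [q jq]].
exists (lpair (lcomp i (lfst M N)) (lcomp j (lsnd M N))),
  (lpair (lcomp p (lfst M' N')) (lcomp q (lsnd M' N'))).
by case=> x y /=; rewrite ip jq.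
Qed.

Lemma iso_dsum M M' N N' : isomorphic M M' -> isomorphic N N' ->
  isomorphic (dsum M N) (dsum M' N').
Proof.
move=> /isomorphicP[i [p [ip pi]]] /isomorphicP[j [q [jq qj]]].
apply/isomorphicP.
exists (lpair (lcomp i (lfst M N)) (lcomp j (lsnd M N))),
  (lpair (lcomp p (lfst M' N')) (lcomp q (lsnd M' N'))).
by split; case=> x y /=; rewrite ?ip ?jq ?pi ?qj.
Qed.

Lemma iso_dsumA M N P : isomorphic (dsum M (dsum N P)) (dsum (dsum M N) P).
Proof.
apply/isomorphicP.
exists (lpair (lpair (lfst M (dsum N P))
    (lcomp (lfst N P) (lsnd M (dsum N P))))
    (lcomp (lsnd N P) (lsnd M (dsum N P)))),
  (lpair (lcomp (lfst M N) (lfst (dsum M N) P))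
    (lpair (lcomp (lsnd M N) (lfst (dsum M N) P)) (lsnd (dsum M N) P))).
by split; [case=> x [y z]|case=> [[x y] z]].
Qed.

Lemma iso_dsumC M N : isomorphic (dsum M N) (dsum N M).
Proof.
apply/isomorphicP.
exists (lpair (lsnd M N) (lfst M N)), (lpair (lsnd N M) (lfst N M)).
by split; case.
Qed.

Lemma iso_dsumCA M N P :
  isomorphic (dsum M (dsum N P)) (dsum N (dsum M P)).
Proof.
apply: isomorphic_trans (iso_dsumA _ _ _) _.
apply: isomorphic_trans (iso_dsum (iso_dsumC _ _) (isomorphic_refl _)) _.
exact: isomorphic_sym (iso_dsumA _ _ _).
Qed.

Lemma iso_dsum0 Z M : zero_mod Z -> isomorphic (dsum Z M) M.
Proof.
move=> Z0; apply/isomorphicP; exists (lsnd Z M), (linr Z M).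
by split=> // -[x y] /=; rewrite [x]Z0.
Qed.

Lemma retractP N M : direct_summand N M <-> retract N M.
Proof.
split=> [[N' /iso_retract_sym]|[i [p ip]]].
  by apply: retract_trans; apply: retract_dsuml.
have [L [j [ji jE]]] := ker_obj p.
exists L; apply: isomorphic_sym; exists (lcopair i j).
have pj y : p (j y) = 0 by apply/jE; exists y.
apply: inj_surj_bij.
  apply: inj_ker => -[x y] /= xy.
  have x0 : x = 0.
    by have := congr1 p xy; rewrite linearD ip pj addr0 linear0.
  move: xy; rewrite x0 linear0 add0r => /(ker_inj ji) ->.
  by [].
move=> y; have /jE[z zE] : p (y - i (p y)) = 0 by rewrite linearB ip subrr.
by exists (p y, z); rewrite /= zE addrC subrK.
Qed.

Lemma liter_subproof M (f : {linear M -> M}) n : linear (fun x => iter n f x).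
Proof. by move=> a x y; elim: n => //= n ->; rewrite linearP. Qed.
Definition liter M (f : {linear M -> M}) n := mklin (liter_subproof f n).

Lemma fitting M (f : {linear M -> M}) :
  exists n I (i : {linear I -> M}) (e : {linear M -> I}) (r : {linear M -> I}),
  [/\ (0 < n)%N, surj e, forall x, i (e x) = iter n f x & cancel i r].
Proof.
pose D d := `[< exists n I (i : {linear I -> M}) (e : {linear M -> I}),
  [/\ (0 < n)%N, surj e, injective i, forall x, i (e x) = iter n f x
    & cdim I = d] >].
have : exists d, D d.
  have [I [e [i [es ii ie]]]] := image_obj f.
  by exists (cdim I); apply/asboolP; exists 1%N, I, i, e.
case/ex_minnP => d /asboolP[n [I [i [e [n0 es ii ie Id]]]]] dmin.
have eis : surj (lcomp e i).
  have [J [e' [j [es' ji je]]]] := image_obj (liter f (n + n)).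
  have jI x : exists y, i y = j x.
    by have [y <-] := es' x; exists (e (i (e y))); rewrite je !ie /= iterD.
  have [k kE] := lift_inj ii jI.
  have ki : injective k by move=> x y kxy; apply: ji; rewrite -!kE kxy.
  have /(inj_cdim_surj ki) ks : (cdim I <= cdim J)%N.
    rewrite Id; apply: dmin; apply/asboolP; exists (n + n)%N, J, j, e'.
    by split => //; rewrite addn_gt0 n0.
  move=> y; have [z <-] := ks y; have [x <-] := es' z.
  by exists (e x); apply: ii; rewrite /= kE je !ie /= iterD.
have eii : injective (lcomp e i) by apply: surj_cdim_inj.
have [g [gK _]] := lin_inv eii eis.
by exists n, I, i, e, (lcomp g e); split.
Qed.

Lemma endo_inj_surj M (f : {linear M -> M}) : injective f -> surj f.
Proof. by move=> fi; apply: inj_cdim_surj. Qed.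

Lemma endo_surj_inj M (f : {linear M -> M}) : surj f -> injective f.
Proof. by move=> fs; apply: surj_cdim_inj. Qed.

Lemma endo_inj_bij M (f : {linear M -> M}) : injective f -> bijective f.
Proof. by move=> fi; apply: inj_surj_bij => //; apply: endo_inj_surj. Qed.

Lemma endo_surj_bij M (f : {linear M -> M}) : surj f -> bijective f.
Proof. by move=> fs; apply: inj_surj_bij => //; apply: endo_surj_inj. Qed.

Lemma indecomposable_endo M (f : {linear M -> M}) : indecomposable M ->
  bijective f \/ exists n, forall x, iter n f x = 0.
Proof.
move=> [_ Mind]; have [n [I [i [e [r [n0 es ie ir]]]]]] := fitting f.
have [N' iso] : direct_summand I M by apply/retractP; exists i, r.
case: (Mind _ _ iso) => [I0|N0]; [right|left].
  by exists n => x; rewrite -ie [e x]I0 linear0.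
have /isomorphicP[g [h [gh hg]]] := iso.
have is_ : surj i.
  apply: inj_cdim_surj; first exact: can_inj ir.
  apply: (surj_cdim (f := lcomp h (linl I N'))) => y.
  exists (g y).1; rewrite -[RHS]gh /=; congr (h _).
  by case: (g y) => a b /=; rewrite [b]N0.
apply: endo_surj_bij => y; have [z <-] := is_ y; have [x <-] := es z.
by exists (iter n.-1 f x); rewrite ie -iterS prednK.
Qed.

Lemma indecomposable_local M (f g : {linear M -> M}) : indecomposable M ->
  (forall x, f x + g x = x) -> bijective f \/ bijective g.
Proof.
move=> Mind fg; case: (indecomposable_endo f Mind) => [|[n fn]]; first by left.
right; apply: endo_inj_bij; apply: inj_ker => x gx.
have fx : f x = x by rewrite -[RHS]fg gx addr0.
by rewrite -(fn x); elim: n {fn} => //= n <-; rewrite fx.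
Qed.

Lemma bij_retract M N (f : {linear M -> N}) (g : {linear N -> M}) :
  bijective (fun x => g (f x)) -> retract M N.
Proof.
move=> gfb; have gfb' : bijective (lcomp g f) by [].
have [h [hK _]] := lin_inv (bij_inj gfb') (bij_surj gfb').
by exists f, (lcomp h g).
Qed.

Lemma indecomposable_retract_dsum N X Y : indecomposable N ->
  retract N (dsum X Y) -> retract N X \/ retract N Y.
Proof.
move=> Nind [i [p ip]].
pose f := lcomp (lcomp p (linl X Y)) (lcomp (lfst X Y) i).
pose g := lcomp (lcomp p (linr X Y)) (lcomp (lsnd X Y) i).
case: (@indecomposable_local _ f g Nind); last 2 first.
- by move=> /bij_retract; left.
- by move=> /bij_retract; right.
move=> x; rewrite /= -linearD -[RHS]ip; congr (p _).
by case: (i x) => a b; congr pair; rewrite /= ?addr0 ?add0r.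
Qed.

Lemma zero_fg_subproof : finitely_generated ('rV[A^c]_0 : lmodType A^c).
Proof.
exists 0%N, (fun _ => 0) => x; exists (fun _ => 0).
by rewrite big_ord0; apply/rowP => -[].
Qed.
Definition zero_fg : fgmod A := FgMod zero_fg_subproof.

Arguments zero_fg : simpl never.

Lemma zero_fgP : zero_mod zero_fg.
Proof. by move=> x; apply/rowP => -[]. Qed.

Fixpoint dsums l : fgmod A :=
  if l is N :: l' then dsum N (dsums l') else zero_fg.

Arguments dsums : simpl never.

Fixpoint inds l := if l is N :: l' then indecomposable N /\ inds l' else True.

Fixpoint mem_iso N l :=
  if l is N' :: l' then isomorphic N N' \/ mem_iso N l' else False.

Fixpoint niso l := if l is N :: l' then ~ mem_iso N l' /\ niso l' else True.

Lemma iso_dsums_cat l m :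
  isomorphic (dsums (l ++ m)) (dsum (dsums l) (dsums m)).
Proof.
elim: l => [|N l IH] /=; first exact: isomorphic_sym (iso_dsum0 _ zero_fgP).
exact: isomorphic_trans (iso_dsum (isomorphic_refl _) IH) (iso_dsumA _ _ _).
Qed.

Lemma inds_cat l m : inds l -> inds m -> inds (l ++ m).
Proof. by elim: l => //= N l IH [Nind lind] mind; split => //; apply: IH. Qed.

Lemma zero_cdim_dsum M N N' : isomorphic M (dsum N N') -> ~ zero_mod N' ->
  (cdim N < cdim M)%N.
Proof.
move=> /isomorphicP[f [g [fK gK]]] N'0; rewrite ltnNge; apply/negP => dMN.
apply: N'0 => y.
have gi : injective (lcomp g (linl N N')).
  by move=> x x' /(can_inj gK)[].
have [x /(can_inj gK)[]] := inj_cdim_surj gi dMN (g (0, y)).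
by move=> _ <-.
Qed.

Lemma krull_schmidt M : exists2 l, inds l & isomorphic M (dsums l).
Proof.
have [n] := ubnP (cdim M); elim: n M => // n IH M Mn.
have [M0|M0] := pselect (zero_mod M).
  exists nil => //=; apply/isomorphicP; exists (lzero _ _), (lzero _ _).
  by split=> x /=; rewrite ?[x]M0 ?[x]zero_fgP.
have [Mind|Mind] := pselect (indecomposable M).
  exists [:: M]; first by []; rewrite -[dsums _]/(dsum M zero_fg).
  apply: isomorphic_trans _ (iso_dsumC _ _).
  exact: isomorphic_sym (iso_dsum0 _ zero_fgP).
have [N [N' [iso N0 N'0]]] : exists N N',
    [/\ isomorphic M (dsum N N'), ~ zero_mod N & ~ zero_mod N'].
  apply: contrapT => H; apply: Mind; split => // N N' iso.
  apply: contrapT => /not_orP[N0 N'0]; apply: H.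
  by exists N, N'.
have iso' := isomorphic_trans iso (iso_dsumC _ _).
have /IH[l lind il] : (cdim N < n)%N.
  by apply: leq_trans (zero_cdim_dsum iso N'0) _.
have /IH[m mind im] : (cdim N' < n)%N.
  by apply: leq_trans (zero_cdim_dsum iso' N0) _.
exists (l ++ m); first exact: inds_cat.
apply: isomorphic_trans iso _; apply: isomorphic_trans (iso_dsum il im) _.
exact: isomorphic_sym (iso_dsums_cat _ _).
Qed.

Lemma mem_iso_iso X Y l : isomorphic X Y -> mem_iso X l -> mem_iso Y l.
Proof.
move=> XY; elim: l => //= N l IH [XN|/IH]; [left|by right].
exact: isomorphic_trans (isomorphic_sym XY) XN.
Qed.

Lemma mem_iso_retract N l : mem_iso N l -> retract N (dsums l).
Proof.
elim: l => //= N' l IH [/iso_retract NN'|/IH NN'].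
  exact: retract_trans NN' (retract_dsuml _ _).
exact: retract_trans NN' (retract_dsumr _ _).
Qed.

Lemma zero_iso M N : isomorphic M N -> zero_mod M -> zero_mod N.
Proof.
move=> /isomorphicP[f [g [fK gK]]] M0 x.
by rewrite -(gK x) (M0 (g x)) linear0.
Qed.

Lemma retract_zero M N : retract N M -> zero_mod M -> zero_mod N.
Proof. by move=> [i [p ip]] M0 x; rewrite -(ip x) (M0 (i x)) linear0. Qed.

Lemma indecomposable_iso M N :
  isomorphic M N -> indecomposable M -> indecomposable N.
Proof.
move=> MN [M0 Mind]; split=> [N0|N1 N2 iso].
  by apply: M0; apply: zero_iso (isomorphic_sym MN) N0.
by apply: Mind; apply: isomorphic_trans MN iso.
Qed.

Lemma indecomposable_retract_iso M N :
  indecomposable M -> indecomposable N -> retract M N -> isomorphic M N.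
Proof.
move=> [M0 _] [_ Nind] /retractP[N' iso].
case: (Nind _ _ iso) => // N'0; apply: isomorphic_sym.
apply: isomorphic_trans iso _; apply: isomorphic_trans (iso_dsumC _ _) _.
exact: iso_dsum0.
Qed.

Lemma retract_mem_iso N l : indecomposable N -> inds l ->
  retract N (dsums l) -> mem_iso N l.
Proof.
move=> Nind; elim: l => [_ |N' l IH [Nind' lind]] /=.
  by move=> /retract_zero/(_ zero_fgP); case: Nind.
case/(indecomposable_retract_dsum Nind) => [NN'|]; last by right; apply: IH.
by left; apply: indecomposable_retract_iso.
Qed.

Lemma mem_iso_ind N l : inds l -> mem_iso N l -> indecomposable N.
Proof.
elim: l => //= N' l IH [Nind' lind] [NN'|]; last exact: IH.
exact: indecomposable_iso (isomorphic_sym NN') Nind'.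
Qed.

Lemma mem_iso_extract N l : mem_iso N l -> niso l -> inds l ->
  exists l', [/\ isomorphic (dsums l) (dsum N (dsums l')), niso l', inds l',
    ~ mem_iso N l' & forall X, mem_iso X l <-> isomorphic X N \/ mem_iso X l'].
Proof.
elim: l => //= N' l IH Nl [N'l ln] [Nind' lind].
have [NN'|nNN'] := pselect (isomorphic N N').
  exists l; split=> // [||X].
  - exact: (@iso_dsum N' N (dsums l)) (isomorphic_sym NN') (isomorphic_refl _).
  - by move=> /(mem_iso_iso NN').
  - split=> -[XN|]; try by right.
      by left; apply: isomorphic_trans XN (isomorphic_sym NN').
    by left; apply: isomorphic_trans XN NN'.
case: Nl => // Nl; have [l' [iso ln' lind' Nl' lE]] := IH Nl ln lind.
exists (N' :: l'); split.
- apply: isomorphic_trans _ (iso_dsumCA N' N (dsums l')).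
  exact: (@iso_dsum N' N' (dsums l)) (isomorphic_refl _) iso.
- by split=> // N'l'; apply: N'l; apply/lE; right.
- by [].
- by case.
- by move=> X /=; rewrite lE; tauto.
Qed.

Lemma niso_unique l m : inds l -> inds m -> niso l -> niso m ->
  (forall X, mem_iso X l <-> mem_iso X m) -> isomorphic (dsums l) (dsums m).
Proof.
elim: l m => [|N l IH] m /=.
  case: m => [|N m] _ _ _ _ /= lm; first exact: isomorphic_refl.
  by have [] := (lm N).2 (or_introl (isomorphic_refl N)).
move=> [Nind lind] mind [Nl ln] mn lm.
have Nm : mem_iso N m by apply/lm; left; apply: isomorphic_refl.
have [m' [iso mn' mind' Nm' mE]] := mem_iso_extract Nm mn mind.
apply: isomorphic_trans _ (isomorphic_sym iso).
apply: (@iso_dsum N N (dsums l)) (isomorphic_refl _) _; apply: IH => // X.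
have := lm X; rewrite mE => lmX; split=> Xm.
  case: (lmX.1 (or_intror Xm)) => // XN.
  by case: Nl; apply: mem_iso_iso XN Xm.
case: (lmX.2 (or_intror Xm)) => // XN.
by case: Nm'; apply: mem_iso_iso XN Xm.
Qed.

Lemma basic_retract M N : retract N M -> basic M -> basic N.
Proof.
move=> NM Mb X Xind /retractP XN; apply: (Mb X Xind); apply/retractP.
exact: retract_trans XN NM.
Qed.

Lemma basic_niso l : inds l -> basic (dsums l) -> niso l.
Proof.
elim: l => //= N l IH [Nind lind] b; split; last first.
  by apply: IH => //; apply: basic_retract b; apply: retract_dsumr.
move=> /mem_iso_retract Nl; apply: (b N Nind); apply/retractP.
exact: retract_dsum (retract_refl _) Nl.
Qed.

(* Modulo maps factoring through [W], which are not bijective, the identity of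
   [N + N] would be a 2 x 2 matrix [a_i b_j] of rank one over the local ring
   [End N]: the entries [a_1 b_1] and [a_2 b_2] are bijective, hence so is
   [a_1 b_2], which should vanish. *)
Lemma retract_square N W : indecomposable N ->
  retract (dsum N N) (dsum N W) -> retract N W.
Proof.
move=> Nind [i [p ip]]; apply: contrapT => nNW.
pose b j : {linear N -> N} := lcomp (lfst N W) (lcomp i j).
pose v j : {linear N -> W} := lcomp (lsnd N W) (lcomp i j).
pose a (q : {linear dsum N N -> N}) : {linear N -> N} :=
  lcomp q (lcomp p (linl N W)).
pose w (q : {linear dsum N N -> N}) : {linear W -> N} :=
  lcomp q (lcomp p (linr N W)).
have key (q : {linear dsum N N -> N}) (j : {linear N -> dsum N N}) x :
    lcomp (a q) (b j) x + lcomp (w q) (v j) x = q (j x).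
  rewrite /= -!linearD -[in RHS](ip (j x)); congr (q (p _)).
  by case: (i (j x)) => y z; congr pair; rewrite /= ?addr0 ?add0r.
have diag (q : {linear dsum N N -> N}) (j : {linear N -> dsum N N}) :
    (forall x, q (j x) = x) -> bijective (lcomp (a q) (b j)).
  move=> qj; case: (@indecomposable_local N (lcomp (a q) (b j))
    (lcomp (w q) (v j)) Nind) => // [x|/bij_retract //].
  by rewrite key qj.
have /bij_surj s1 := diag (lfst N N) (linl N N) (fun=> erefl).
have /bij_inj i2 := diag (lsnd N N) (linr N N) (fun=> erefl).
have a1 : injective (a (lfst N N)).
  apply: endo_surj_inj => y; have [x <-] := s1 y.
  by exists (b (linl N N) x).
apply: nNW; apply: (@bij_retract _ _ (v (linr N N)) (w (lfst N N))).
apply: (@endo_inj_bij _ (lcomp (w (lfst N N)) (v (linr N N)))).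
apply: inj_ker => x wv0; have := key (lfst N N) (linr N N) x.
rewrite wv0 addr0 /= => /(ker_inj a1) bx.
by apply: (ker_inj i2); rewrite /= bx !linear0.
Qed.

Lemma niso_basic l : inds l -> niso l -> basic (dsums l).
Proof.
move=> lind ln N Nind /retractP NN.
have Nl : mem_iso N l.
  apply: retract_mem_iso => //; apply: retract_trans NN.
  exact: retract_dsuml.
have [l' [iso _ lind' Nl' _]] := mem_iso_extract Nl ln lind.
apply: Nl'; apply: retract_mem_iso => //; apply: retract_square => //.
exact: retract_trans NN (iso_retract iso).
Qed.

Definition additive_class S := [/\ S zero_fg,
  forall X Y, S X -> S Y -> S (dsum X Y) &
  forall X Y, retract Y X -> S X -> S Y].

Lemma add_sub U S : additive_class S -> S U -> subcat_le (add U) S.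
Proof.
move=> [S0 SD Sr] SU X; elim=> [Z Z0|N Y Z /retractP NU _ SY iso].
  apply: (Sr _ _ _ S0); exists (lzero _ _), (lzero _ _) => x.
  by rewrite [RHS]Z0.
by apply: (Sr _ _ (iso_retract iso)); apply: SD => //; apply: (Sr _ _ _ SU).
Qed.

Lemma add_zero_fg U : add U zero_fg.
Proof. exact/add_zero/zero_fgP. Qed.

Lemma add_iso U X Y : isomorphic X Y -> add U X -> add U Y.
Proof.
move=> XY aX; case: aX XY => [Z Z0|N X' Z NU aX' iso] XY.
  exact/add_zero/(zero_iso XY).
by apply: add_dsum NU aX' _; apply: isomorphic_trans (isomorphic_sym XY) iso.
Qed.

Lemma add_closed_dsum U X Y : add U X -> add U Y -> add U (dsum X Y).
Proof.
move=> aX aY; elim: aX => [Z Z0|N X' Z NU _ aX' iso].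
  exact: add_iso (isomorphic_sym (iso_dsum0 _ Z0)) aY.
apply: add_dsum NU aX' _.
apply: isomorphic_trans (isomorphic_sym (iso_dsumA _ _ _)).
exact: iso_dsum iso (isomorphic_refl _).
Qed.

Lemma add_retract U X : retract X U -> add U X.
Proof.
move=> XU; apply: (@add_dsum _ _ U X zero_fg); first exact/retractP.
  exact: add_zero_fg.
apply: isomorphic_sym; apply: isomorphic_trans (iso_dsumC _ _) _.
exact: iso_dsum0 zero_fgP.
Qed.

Lemma add_self U : add U U.
Proof. exact/add_retract/retract_refl. Qed.

Lemma add_indecomposable U X N :
  add U X -> indecomposable N -> retract N X -> retract N U.
Proof.
move=> aX Nind; move: X aX.
apply: (@add_sub U (fun X => retract N X -> retract N U)) => //; split.
- by move=> /retract_zero/(_ zero_fgP); case: Nind.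
- by move=> X Y IX IY /(indecomposable_retract_dsum Nind)[/IX|/IY].
- by move=> X Y YX IX NY; apply: IX; apply: retract_trans NY YX.
Qed.

Lemma dsums_additive S l : additive_class S ->
  (forall N, mem_iso N l -> S N) -> S (dsums l).
Proof.
move=> [S0 SD Sr]; elim: l => [//|N l IH Sl].
apply: (SD N (dsums l)); first by apply: Sl; left; apply: isomorphic_refl.
by apply: IH => N' N'l; apply: Sl; right.
Qed.

Lemma add_additive U : additive_class (add U).
Proof.
split; [exact: add_zero_fg|exact: add_closed_dsum|move=> X Y YX aX].
have [l lind iso] := krull_schmidt Y.
apply: add_iso (isomorphic_sym iso) _.
have : forall N, mem_iso N l -> add U N.
  move=> N Nl; apply: add_retract; apply: (add_indecomposable aX).
    exact: mem_iso_ind lind Nl.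
  apply: retract_trans YX; apply: retract_trans (iso_retract_sym iso).
  exact: mem_iso_retract.
elim: l {lind iso} => [_|N l IH aN]; first exact: add_zero_fg.
apply: (@add_closed_dsum _ N (dsums l)).
  by apply: aN; left; apply: isomorphic_refl.
by apply: IH => N' N'l; apply: aN; right.
Qed.

Lemma add_closed_retract U X Y : retract Y X -> add U X -> add U Y.
Proof. by case: (add_additive U) => _ _; apply. Qed.

Lemma add_le U V : add V U -> subcat_le (add U) (add V).
Proof. by move=> aU; apply: add_sub => //; apply: add_additive. Qed.

Lemma inds_basic_part l S :
  (forall X Y, retract Y X -> S X -> S Y) -> inds l ->
  exists l', [/\ inds l', niso l' &
    forall N, mem_iso N l' <-> mem_iso N l /\ S N].
Proof.
move=> Sr; elim: l => [_|N l IH [Nind lind]].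
  by exists nil; split => // N /=; tauto.
have [l' [lind' ln' lE]] := IH lind.
have SN X : isomorphic X N -> S N <-> S X.
  by move=> /[dup]/iso_retract XN /iso_retract_sym NX; split; apply: Sr.
have [[SN' Nl']|nN] := pselect (S N /\ ~ mem_iso N l').
  exists (N :: l'); split=> //= X; rewrite lE.
  split=> [[XN|[Xl SX]]|[[XN|Xl] SX]].
  - by split; [left|apply/(SN _ XN)].
  - by split; [right|].
  - by left.
  - by right.
exists l'; split=> //= X; split=> [/lE[Xl SX]|[XNl SX]].
  by split; [right|].
case: XNl => [XN|Xl]; last exact/lE.
apply: contrapT => Xl'; case: nN; split; first exact/(SN _ XN).
by move=> /(mem_iso_iso (isomorphic_sym XN)).
Qed.

Lemma basic_part P S : additive_class S ->
  exists V, basic V /\ subcat_eq (add V) (fun X => add P X /\ S X).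
Proof.
move=> [S0 SD Sr]; have [l lind iso] := krull_schmidt P.
have [l' [lind' ln' lE]] := inds_basic_part Sr lind.
have PS_add : additive_class (fun X => add P X /\ S X).
  split=> [|Y Z [aY SY] [aZ SZ]|Y Z ZY [aY SY]].
  - by split=> //; apply: add_zero_fg.
  - by split; [apply: add_closed_dsum|apply: SD].
  - by split; [apply: add_closed_retract _ aY|apply: (Sr _ _ _ SY)].
exists (dsums l'); split; first exact: niso_basic.
move=> X; split=> [|[aX SX]].
  apply: (add_sub PS_add); apply: (dsums_additive PS_add) => N /lE[Nl SN].
  split=> //; apply: add_retract; apply: retract_trans (iso_retract_sym iso).
  exact: mem_iso_retract.
have [m mind isoX] := krull_schmidt X.
apply: add_iso (isomorphic_sym isoX) _.
apply: dsums_additive (add_additive _) _ => N Nm.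
have Nind := mem_iso_ind mind Nm.
have NX : retract N X.
  by apply: retract_trans (iso_retract_sym isoX); apply: mem_iso_retract.
apply/add_retract/mem_iso_retract/lE; split; last exact: (Sr _ _ _ SX).
apply: retract_mem_iso => //; apply: retract_trans (iso_retract iso).
exact: add_indecomposable aX Nind NX.
Qed.

Lemma basic_add_unique V W : basic V -> basic W ->
  subcat_eq (add V) (add W) -> isomorphic V W.
Proof.
move=> Vb Wb VW.
have [l lind isoV] := krull_schmidt V; have [m mind isoW] := krull_schmidt W.
apply: (isomorphic_trans isoV); apply: isomorphic_trans (isomorphic_sym isoW).
have mE U k X : inds k -> isomorphic U (dsums k) ->
    mem_iso X k <-> indecomposable X /\ add U X.
  move=> kind isoU; split=> [Xk|[Xind aX]].
    split; first exact: mem_iso_ind Xk.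
    apply: add_retract; apply: retract_trans (iso_retract_sym isoU).
    exact: mem_iso_retract.
  apply: retract_mem_iso => //; apply: retract_trans (iso_retract isoU).
  exact: add_indecomposable aX Xind (retract_refl _).
apply: niso_unique => //.
- by apply: basic_niso => //; apply: basic_retract _ Vb; apply: iso_retract_sym.
- by apply: basic_niso => //; apply: basic_retract _ Wb; apply: iso_retract_sym.
- by move=> X; rewrite (mE V l) // (mE W m) // VW.
Qed.

End KrullSchmidt.

Arguments zero_fg {K A} : simpl never.

(** * Extensions and torsion classes *)

Section Ext.
Variables (K : closedFieldType) (A : falgType K).
Implicit Types (I L M N P Q U V W X Y Z : fgmod A).
Implicit Types S T C E : subcat A.

Lemma short_exactP M N P (i : {linear M -> N}) (p : {linear N -> P}) :
  short_exact i p <->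
  [/\ injective i, forall x, p x = 0 <-> exists y, i y = x & surj p].
Proof.
split=> -[ii ip ps]; split => //; try exact/surjP.
  by move=> x; have -> : (p x = 0) = range i x;
    [rewrite ip|split=> [[y _]|[y]]; exists y].
by apply/seteqP; split=> x; [case=> y _ yx; apply/ip|move=> /ip[y]]; exists y.
Qed.

Lemma ker_short_exact M N (p : {linear M -> N}) : surj p ->
  exists L (i : {linear L -> M}), short_exact i p.
Proof.
move=> ps; have [L [i [ii ip]]] := ker_obj p.
by exists L, i; apply/short_exactP.
Qed.

Lemma min_cdim S : (exists X, S X) ->
  exists X, S X /\ forall Y, S Y -> (cdim X <= cdim Y)%N.
Proof.
move=> [X SX]; pose D d := `[< exists Y, S Y /\ cdim Y = d >].
have : exists d, D d by exists (cdim X); apply/asboolP; exists X.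
case/ex_minnP => d /asboolP[Y [SY <-]] dmin.
by exists Y; split=> // Z SZ; apply: dmin; apply/asboolP; exists Z.
Qed.

Lemma Ext1_lift M Y X Z (i : {linear Y -> X}) (p : {linear X -> Z})
    (g : {linear M -> Z}) :
  short_exact i p -> Ext1_zero M Y ->
  exists h : {linear M -> X}, forall m, p (h m) = g m.
Proof.
move=> /short_exactP[ii ip ps] MY.
pose d : {linear dsum X M -> Z} := lcopair p (lcomp g (lksc (-1) (lid M))).
have dE u : d u = 0 <-> p u.1 = g u.2.
  rewrite /= kscN1 linearN; split=> [/eqP|->]; last by rewrite subrr.
  by rewrite subr_eq0 => /eqP.
have [E [e [ei eE]]] := ker_obj d.
pose pi : {linear E -> M} := lcomp (lsnd X M) e.
have [|iota iotaE] := @lift_inj _ _ _ _ e (lpair i (lzero Y M)) ei.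
  by move=> y; apply/eE/dE; rewrite /= linear0; apply/ip; exists y.
have : short_exact iota pi.
  apply/short_exactP; split.
  - move=> y y' /(congr1 e); rewrite !iotaE => -[]; exact: ii.
  - move=> u; split=> [u0|[y <-]]; last by rewrite /= iotaE.
    have /dE : d (e u) = 0 by apply/eE; exists u.
    rewrite /= in u0; rewrite u0 linear0 => /ip[y yE].
    exists y; apply: ei; rewrite iotaE /= yE -u0.
    by case: (e u).
  - move=> m; have [x xm] := ps (g m).
    have /eE[u uE] : d (x, m) = 0 by apply/dE.
    by exists u; rewrite /= uE.
move=> /MY[s sK]; exists (lcomp (lfst X M) (lcomp e s)) => m.
have /dE : d (e (s m)) = 0 by apply/eE; exists (s m).
by rewrite /= => ->; congr (g _); apply: sK.
Qed.

Lemma Ext1_extend M N Y X (i : {linear Y -> X}) (p : {linear X -> M})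
    (f : {linear Y -> N}) :
  short_exact i p -> Ext1_zero M N ->
  exists h : {linear X -> N}, forall y, h (i y) = f y.
Proof.
move=> /short_exactP[ii ip ps] MN.
pose d : {linear Y -> dsum N X} := lpair f (lksc (-1) i).
have dE y : d y = (f y, - i y) by rewrite /= kscN1.
have [Q [q [qs qE]]] := fgquot_obj (submodule_range d).
have qd y : q (0, i y) = q (f y, 0).
  apply/eqP; rewrite eq_sym -subr_eq0 -linearB; apply/eqP/qE.
  exists y => //; rewrite dE; congr pair; rewrite /= ?subr0 //.
  exact: (esym (sub0r (i y))).
pose iota : {linear N -> Q} := lcomp q (linl N X).
have [|pi piE] := @desc_surj _ _ _ _ q (lcomp p (lsnd N X)) qs.
  move=> u /qE[y _ <-]; rewrite dE /= linearN.
  by rewrite (_ : p (i y) = 0) ?oppr0 //; apply/ip; exists y.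
have qD n x : q (n, x) = q (n, 0) + q (0, x).
  by rewrite -[RHS]linearD; congr (q (_, _)); rewrite /= ?addr0 ?add0r.
have : short_exact iota pi.
  apply/short_exactP; split.
  - apply: inj_ker => n /qE[y _]; rewrite dE => -[<- /eqP].
    rewrite oppr_eq0 => /eqP /(ker_inj ii) ->; exact: linear0.
  - move=> u; have [[n x] <-] := qs u; rewrite piE /=.
    split=> [/ip[y <-]|[n' e]].
      exists (n + f y); rewrite (qD n (i y)) qd -[RHS]linearD; congr (q (_, _)).
      exact/esym/addr0.
    by have := piE (n', 0); rewrite [q _]e piE /= linear0.
  - move=> m; have [x <-] := ps m; exists (q (0, x)); exact: piE.
move=> /[dup]/MN[s sK] /short_exactP[io_inj io_ker _].
have [|h hE] := @lift_inj _ _ _ _ iota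
  (lsub (lcomp q (linr N X)) (lcomp s p)) io_inj.
  by move=> x; apply/io_ker; rewrite /= linearB piE sK subrr.
exists h => y; apply: io_inj; rewrite hE /= (_ : p (i y) = 0) ?linear0 ?addr0.
  exact: qd.
by apply/ip; exists y.
Qed.

Lemma Ext1_zeroP M Y :
  (forall X (i : {linear Y -> X}) (p : {linear X -> M}), short_exact i p ->
     exists s : {linear M -> X}, bijective (fun x => p (s x))) -> Ext1_zero M Y.
Proof.
move=> H X i p se; have [s sb] := H X i p se.
have sb' : bijective (lcomp p s) by [].
have [g [_ gK]] := lin_inv (bij_inj sb') (bij_surj sb').
by exists (lcomp s g).
Qed.

Lemma Ext1_additive Y : additive_class (fun M => Ext1_zero M Y).
Proof.
split=> [|M N MY NY|M N [j [q jq]] MY] X i p se.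
- by exists (lzero _ _) => x; rewrite [RHS]zero_fgP linear0.
- have [h hE] := @Ext1_lift M Y X (dsum M N) i p (linl M N) se MY.
  have [k kE] := @Ext1_lift N Y X (dsum M N) i p (linr M N) se NY.
  exists (lcopair h k) => -[m n]; rewrite /= linearD hE kE.
  by congr pair; rewrite /= ?addr0 ?add0r.
- have [h hE] := Ext1_lift q se MY.
  by exists (lcomp h j) => n; rewrite hE jq.
Qed.

Lemma add_Ext1 U X Y : Ext1_zero U Y -> add U X -> Ext1_zero X Y.
Proof. by move=> UY; apply: (add_sub (Ext1_additive Y)). Qed.

Lemma horseshoe_surj M N P X Y (i : {linear M -> N}) (p : {linear N -> P})
    (a : {linear X -> M}) (c : {linear Y -> N}) :
  short_exact i p -> surj a -> surj (lcomp p c) ->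
  surj (lcopair (lcomp i a) c).
Proof.
move=> /short_exactP[ii ip ps] as_ cs n; have [y yE] := cs (p n).
have /ip[m mE] : p (n - c y) = 0 by rewrite linearB -yE /= subrr.
have [x xE] := as_ m.
by exists (x, y); rewrite /= xE mE subrK.
Qed.

Definition Fac U : subcat A :=
  fun M => exists X (p : {linear X -> M}), add U X /\ surj p.

Lemma surj_comp M N P (g : {linear N -> P}) (f : {linear M -> N}) :
  surj g -> surj f -> surj (lcomp g f).
Proof.
by move=> gs fs z; have [y <-] := gs z; have [x <-] := fs y; exists x.
Qed.

Lemma Fac_quotient U M N (p : {linear M -> N}) : surj p -> Fac U M -> Fac U N.
Proof.
move=> ps [X [q [aX qs]]]; exists X, (lcomp p q); split => //.
exact: surj_comp.
Qed.

Lemma retract_surj M N : retract N M -> exists p : {linear M -> N}, surj p.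
Proof. by move=> [i [p ip]]; exists p => y; exists (i y). Qed.

Lemma Fac_iso U M N : isomorphic M N -> Fac U M -> Fac U N.
Proof. by move=> [f /bij_surj fs]; apply: Fac_quotient. Qed.

Lemma add_Fac U X : add U X -> Fac U X.
Proof. by move=> aX; exists X, (lid X); split => // x; exists x. Qed.

Lemma Fac_ext U M N P (i : {linear M -> N}) (p : {linear N -> P}) :
  (forall Y, Fac U Y -> Ext1_zero U Y) ->
  short_exact i p -> Fac U M -> Fac U P -> Fac U N.
Proof.
move=> Ur se FM [Y [q [aY qs]]]; have [X [a [aX as_]]] := FM.
have [c cE] := Ext1_lift q se (add_Ext1 (Ur M FM) aY).
exists (dsum X Y), (lcopair (lcomp i a) c); split.
  exact: add_closed_dsum.
apply: horseshoe_surj se as_ _ => y; have [x <-] := qs y.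
by exists x; apply: cE.
Qed.

Lemma Fac_torsion_class U :
  (forall Y, Fac U Y -> Ext1_zero U Y) -> torsion_class (Fac U).
Proof.
move=> Ur; split=> [M N|//|M N P i p [_ _ _ se]]; first exact: Fac_iso.
split; first exact: Fac_ext se.
by apply: (@Fac_quotient U N P p); case/short_exactP: se.
Qed.

Lemma torsion_class_quotient T M N (p : {linear M -> N}) :
  torsion_class T -> surj p -> T M -> T N.
Proof.
move=> [_ _ Tc] ps TM; have [L [i se]] := ker_short_exact ps.
by have [_] := Tc _ _ _ i p (And4 I I I se); apply.
Qed.

Lemma torsion_class_ext T M N P (i : {linear M -> N}) (p : {linear N -> P}) :
  torsion_class T -> short_exact i p -> T M -> T P -> T N.
Proof. by move=> [_ _ Tc] se; have [] := Tc _ _ _ i p (And4 I I I se). Qed.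

Lemma dsum_short_exact M N :
  @short_exact _ _ M (dsum M N) N (linl M N) (lsnd M N).
Proof.
apply/short_exactP; split=> [x y []//|[x y]|y]; last by exists (0, y).
by split=> /= [->|[z [_ <-]] //]; exists x.
Qed.

Lemma torsion_class_additive T M : torsion_class T -> T M -> additive_class T.
Proof.
move=> Tt TM; split=> [|X Y TX TY|X Y /retract_surj[p ps]].
- apply: (torsion_class_quotient (p := lzero M zero_fg) Tt _ TM) => x.
  by exists 0; rewrite [RHS]zero_fgP.
- exact: torsion_class_ext (dsum_short_exact X Y) TX TY.
- exact: torsion_class_quotient ps.
Qed.

Lemma torsion_class_Fac T U : torsion_class T -> T U -> subcat_le (Fac U) T.
Proof.
move=> Tt TU M [X [p [aX ps]]]; apply: torsion_class_quotient ps _ => //.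
exact: add_sub (torsion_class_additive Tt TU) TU _ aX.
Qed.

Lemma T1_sub C : subcat_le C (T1 C).
Proof. by move=> M CM T _; apply. Qed.

Lemma T1_torsion_class C : torsion_class (T1 C).
Proof.
split=> [M N iso TM T Tt CT|//|M N P i p [_ _ _ se]].
  by have [Ti _ _] := Tt; apply: Ti iso _; apply: TM.
split=> [TM TP T Tt CT|TN T Tt CT].
  by apply: torsion_class_ext se _ _ => //; [apply: TM|apply: TP].
apply: (torsion_class_quotient (p := p)) => //; last exact: TN.
by case/short_exactP: se.
Qed.

Lemma torsion_class_in_quotient E C M N P (i : {linear M -> N})
    (p : {linear N -> P}) :
  torsion_class_in E C -> short_exact i p -> E M -> E P -> C N -> C P.
Proof.
move=> [_ CE Cc] se EM EP CN.
have [_] := Cc _ _ _ i p (And4 EM (CE _ CN) EP se).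
exact.
Qed.

Lemma two_fold_additive C M :
  two_fold_torsion_class C -> C M -> additive_class C.
Proof.
move=> [T Tt Ct] CM; have [_ CT Cc] := Ct.
have [T0 TD Tr] := torsion_class_additive Tt (CT _ CM).
split=> [|X Y CX CY|X Y /retractP[Z XYZ] CX].
- pose p := lzero M zero_fg.
  have : short_exact (lid M) p.
    apply/short_exactP; split=> // x; last by exists 0; rewrite [RHS]zero_fgP.
    by split=> // _; exists x.
  by move=> /(torsion_class_in_quotient Ct); apply => //; apply: CT.
- have se := dsum_short_exact X Y.
  have TXY := TD _ _ (CT _ CX) (CT _ CY).
  by have [H _] := Cc _ _ _ _ _ (And4 (CT _ CX) TXY (CT _ CY) se); apply: H.
- have TX := CT _ CX.
  have [Ci _ _] := Ct.
  have CZY : C (dsum Z Y).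
    by apply: Ci CX; apply: isomorphic_trans XYZ (iso_dsumC _ _).
  apply: (torsion_class_in_quotient Ct (dsum_short_exact Z Y)) CZY.
    apply: (Tr _ _ _ TX); apply: retract_trans (iso_retract_sym XYZ).
    exact: retract_dsumr.
  apply: (Tr _ _ _ TX); apply: retract_trans (iso_retract_sym XYZ).
  exact: retract_dsuml.
Qed.

Lemma cok1P U M : cok1 U M <->
  exists U0 L (i : {linear L -> U0}) (g : {linear U0 -> M}),
  [/\ add U U0, Fac U L & short_exact i g].
Proof.
split=> [[U1 [U0 [f [g [a1 a0 fg gs]]]]]|[U0 [L [i [g [a0 FL se]]]]]].
  have [L [e [i [es ii ie]]]] := image_obj f.
  exists U0, L, i, g; split=> //; first by exists U1, e.
  split=> //; rewrite -fg; apply/seteqP; split=> x [y _ <-].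
    by have [z <-] := es y; exists z.
  by exists (e y).
have [X [p [aX ps]]] := FL; have [ii ig gs] := se.
exists X, U0, (lcomp i p), g; split=> //; rewrite -ig.
apply/seteqP; split=> x [y _ <-] /=; first by exists (p y).
by have [z <-] := ps y; exists z.
Qed.

Lemma cok1_Fac U : subcat_le (cok1 U) (Fac U).
Proof.
by move=> M [U1 [U0 [f [g [_ a0 _ /surjP gs]]]]]; exists U0, g.
Qed.

Lemma cok1_self U : cok1 U U.
Proof.
exists zero_fg, U, (lzero _ _), (lid U); split.
- exact: add_zero_fg.
- exact: add_self.
- apply/seteqP; split=> [x [y _ <-] //|x x0].
  by exists 0 => //; apply: (esym x0).
- by apply/surjP => x; exists x.
Qed.

Lemma cok1_iso U : iso_closed (cok1 U).
Proof.
move=> M N [h hb] [U1 [U0 [f [g [a1 a0 fg /surjP gs]]]]].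
exists U1, U0, f, (lcomp h g); split=> //.
  rewrite fg; apply/seteqP; split=> x; rewrite /kernel /=.
    by move=> ->; rewrite linear0.
  by move=> /(ker_inj (bij_inj hb)).
exact/surjP/surj_comp/gs/bij_surj.
Qed.

Lemma cok1_torsion_class_in U : (forall Y, Fac U Y -> Ext1_zero U Y) ->
  torsion_class_in (Fac U) (cok1 U).
Proof.
move=> Ur; split; [exact: cok1_iso|exact: cok1_Fac|].
move=> M N P i p [FM FN FP se]; split.
  move=> /cok1P[X [LM [j [a [aX FL seM]]]]] /cok1P[Y [LP [k [b [aY FLP seP]]]]].
  have [ji aj as_] := (short_exactP _ _).1 seM.
  have [ki bk bs] := (short_exactP _ _).1 seP.
  have [ii ip ps] := (short_exactP _ _).1 se.
  have [c cE] := Ext1_lift b se (add_Ext1 (Ur M FM) aY).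
  pose h : {linear dsum X Y -> N} := lcopair (lcomp i a) c.
  have hs : surj h.
    apply: horseshoe_surj se as_ _ => y; have [x <-] := bs y.
    by exists x; apply: cE.
  have [L [l lE]] := ker_short_exact hs.
  have [li lh _] := (short_exactP _ _).1 lE.
  have pia x : p (i x) = 0 by apply/ip; exists x.
  apply/cok1P; exists (dsum X Y), L, l, h; split=> //.
    exact: add_closed_dsum.
  have [x|u uE] := @lift_inj _ _ _ _ l (lcomp (linl X Y) j) li.
    apply/lh; rewrite /= !linear0 addr0 (_ : a (j x) = 0) ?linear0 //.
    by apply/aj; exists x.
  have [x|v vE] := @lift_inj _ _ _ _ k (lcomp (lsnd X Y) l) ki.
    apply/bk; rewrite /= -cE; have : h (l x) = 0 by apply/lh; exists x.
    by rewrite /= => /(congr1 p); rewrite linearD pia add0r linear0.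
  apply: (@Fac_ext U LM L LP u v) => //; apply/short_exactP; split.
  - by move=> x y /(congr1 l); rewrite !uE /= => -[/ji].
  - move=> x; split=> [vx|[y <-]]; last first.
      by apply: (ker_inj ki); rewrite vE /= uE.
    have l2 : (l x).2 = 0.
      by rewrite -[LHS]/(lcomp (lsnd X Y) l x) -vE vx linear0.
    have : h (l x) = 0 by apply/lh; exists x.
    rewrite /= l2 linear0 addr0 => /(ker_inj ii) /aj[y yE].
    exists y; apply: li; rewrite uE /= yE -l2.
    by case: (l x).
  - move=> y; have : p (c (k y)) = 0 by rewrite cE; apply/bk; exists y.
    move=> /ip[m mE]; have [x xE] := as_ m.
    have /lh[z zE] : h (- x, k y) = 0 by rewrite /= !linearN xE mE addNr.
    by exists z; apply: ki; rewrite vE /= zE.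
move=> /cok1P[X [L [j [b [aX FL seN]]]]].
have [ji bj bs] := (short_exactP _ _).1 seN.
have [ii ip ps] := (short_exactP _ _).1 se.
have hs : surj (lcomp p b) by apply: surj_comp.
have [L' [l lE]] := ker_short_exact hs.
have [li lh _] := (short_exactP _ _).1 lE.
apply/cok1P; exists X, L', l, (lcomp p b); split=> //.
have [x|u uE] := @lift_inj _ _ _ _ l j li.
  by apply/lh; rewrite /= (_ : b (j x) = 0) ?linear0 //; apply/bj; exists x.
have [x|v vE] := @lift_inj _ _ _ _ i (lcomp b l) ii.
  by apply/ip; apply/lh; exists x.
apply: (@Fac_ext U L L' M u v) => //; apply/short_exactP; split.
- by move=> x y /(congr1 l); rewrite !uE => /ji.
- move=> x; split=> [vx|[y <-]].
    have /bj[y yE] : b (l x) = 0 by rewrite -[LHS]/(lcomp b l x) -vE vx linear0.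
    by exists y; apply: li; rewrite uE.
  by apply: (ker_inj ii); rewrite vE /= uE; apply/bj; exists y.
- move=> m; have [x xE] := bs (i m).
  have /lh[z zE] : lcomp p b x = 0 by rewrite /= xE; apply/ip; exists m.
  by exists z; apply: ii; rewrite vE /= zE.
Qed.

Lemma T1_cok1 U : (forall Y, Fac U Y -> Ext1_zero U Y) -> T1 (cok1 U) = Fac U.
Proof.
move=> Ur; apply/funext => M; apply/propext; split=> [TM|FM T Tt CT].
  by apply: TM; [apply: Fac_torsion_class|apply: cok1_Fac].
by apply: torsion_class_Fac FM => //; apply: CT; apply: cok1_self.
Qed.

End Ext.

(** * Approximations and Ext-progenerators *)

Section Approximations.
Variables (K : closedFieldType) (A : falgType K).
Implicit Types (I L M N P Q U V W X Y Z : fgmod A).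
Implicit Types S T C E : subcat A.

Lemma free_fg_subproof n : finitely_generated ('rV[A^c]_n : lmodType A^c).
Proof.
exists n, (fun i => delta_mx 0 i) => x; exists (fun i => x 0 i).
exact: row_sum_delta.
Qed.
Definition free n : fgmod A := FgMod (free_fg_subproof n).

Lemma free_map_subproof n M (g : 'I_n -> M) :
  linear (fun v : 'rV[A^c]_n => \sum_i v 0 i *: g i).
Proof.
move=> a u v; rewrite scaler_sumr -big_split; apply: eq_bigr => i _ /=.
by rewrite !mxE scalerDl scalerA.
Qed.
Definition free_map n M (g : 'I_n -> M) : {linear free n -> M} :=
  mklin (free_map_subproof g).

Lemma free_map_delta n M (g : 'I_n -> M) i :
  free_map g (delta_mx 0 i : 'rV[A^c]_n) = g i.
Proof.
rewrite /= (bigD1 i) //= big1 => [|j ji]; rewrite !mxE ?eqxx /=.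
  by rewrite scale1r addr0.
by rewrite (negbTE ji) scale0r.
Qed.

Lemma free_mapE n M (f : {linear free n -> M}) x :
  f x = free_map (fun i => f (delta_mx 0 i : 'rV[A^c]_n)) x.
Proof.
rewrite /= {1}[x](row_sum_delta (x : 'rV[A^c]_n)) linear_sum.
by apply: eq_bigr => i _; rewrite linearZ.
Qed.

Lemma free_surj M : exists n (p : {linear free n -> M}), surj p.
Proof.
have [n [g gP]] := fgmod_fg M; exists n, (free_map g) => x.
have [c ->] := gP x; exists (\row_i c i : 'rV[A^c]_n) => /=.
by apply: eq_bigr => i _; rewrite mxE.
Qed.

Lemma free_lift n M N (g : {linear M -> N}) (f : {linear free n -> N}) :
  (forall v, exists x, g x = f v) ->
  exists h : {linear free n -> M}, forall x, g (h x) = f x.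
Proof.
move=> gf.
have /choice[m mE] i := gf (delta_mx 0 i : 'rV[A^c]_n).
exists (free_map m) => x; rewrite (free_mapE f) linear_sum.
by apply: eq_bigr => i _; rewrite linearZ /= mE.
Qed.

Lemma hom_list n U M (h : 'I_n -> {linear U -> M}) :
  exists X (f : {linear X -> M}), add U X /\
  forall i, exists k : {linear U -> X}, forall u, f (k u) = h i u.
Proof.
elim: n h => [|n IH] h.
  by exists zero_fg, (lzero _ _); split => [|[]//]; apply: add_zero_fg.
have [X [f [aX fE]]] := IH (fun i => h (lift ord0 i)).
exists (dsum U X), (lcopair (h ord0) f); split.
  by apply: add_closed_dsum aX; apply: add_self.
move=> i; case: (unliftP ord0 i) => [j ->|->].
  have [k kE] := fE j; exists (lcomp (linr U X) k) => u.
  by rewrite /= linear0 add0r kE.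
by exists (linl U X) => u; rewrite /= linear0 addr0.
Qed.

Lemma hom_colist n U M (h : 'I_n -> {linear M -> U}) :
  exists X (f : {linear M -> X}), add U X /\
  forall i, exists k : {linear X -> U}, forall x, k (f x) = h i x.
Proof.
elim: n h => [|n IH] h.
  by exists zero_fg, (lzero _ _); split => [|[]//]; apply: add_zero_fg.
have [X [f [aX fE]]] := IH (fun i => h (lift ord0 i)).
exists (dsum U X), (lpair (h ord0) f); split.
  by apply: add_closed_dsum aX; apply: add_self.
move=> i; case: (unliftP ord0 i) => [j ->|->].
  by have [k kE] := fE j; exists (lcomp k (lsnd U X)) => u; rewrite /= kE.
by exists (lfst U X).
Qed.

Lemma right_factor_additive M X (f : {linear X -> M}) :
  additive_class (fun Y => forall g : {linear Y -> M},
    exists h : {linear Y -> X}, forall y, f (h y) = g y).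
Proof.
split=> [g|Y Z fY fZ g|Y Z [i [p ip]] fY g].
- by exists (lzero _ _) => y; rewrite [y]zero_fgP !linear0.
- have [h hE] := fY (lcomp g (linl Y Z)).
  have [k kE] := fZ (lcomp g (linr Y Z)).
  exists (lcopair h k) => -[y z]; rewrite /= linearD hE kE /= -linearD.
  by congr (g (_, _)); rewrite /= ?addr0 ?add0r.
- have [h hE] := fY (lcomp g p).
  by exists (lcomp h i) => y; rewrite /= hE /= ip.
Qed.

Lemma left_factor_additive M X (f : {linear M -> X}) :
  additive_class (fun Y => forall g : {linear M -> Y},
    exists h : {linear X -> Y}, forall x, h (f x) = g x).
Proof.
split=> [g|Y Z fY fZ g|Y Z [i [p ip]] fY g].
- by exists (lzero _ _) => y; rewrite [RHS]zero_fgP.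
- have [h hE] := fY (lcomp (lfst Y Z) g).
  have [k kE] := fZ (lcomp (lsnd Y Z) g).
  exists (lpair h k) => x; rewrite /= hE kE /=.
  by case: (g x).
- have [h hE] := fY (lcomp i g).
  by exists (lcomp p h) => y; rewrite /= hE /= ip.
Qed.

Lemma hom_span_all M N : exists n (h : 'I_n -> {linear M -> N}),
  forall f : {linear M -> N},
    exists c, forall x, f x = \sum_i ksc (c i) (h i x).
Proof.
have [||n [h [_ hE]]] := @hom_span K A M N (fun _ => True); [by []|by []|].
by exists n, h => f; apply: hE.
Qed.

Lemma right_add_approximation U M :
  exists X (f : {linear X -> M}), right_approximation (add U) f.
Proof.
have [n [h hE]] := hom_span_all U M; have [X [f [aX fE]]] := hom_list h.
exists X, f; split=> // Y g aY; move: Y aY g.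
apply: (add_sub (right_factor_additive f)) => g.
have [c cE] := hE g; have [k kE] := choice fE.
exists (lsum c k) => u; rewrite cE /= linear_sum.
by apply: eq_bigr => i _; rewrite linear_ksc kE.
Qed.

Lemma left_add_approximation U M :
  exists X (f : {linear M -> X}), left_approximation (add U) f.
Proof.
have [n [h hE]] := hom_span_all M U; have [X [f [aX fE]]] := hom_colist h.
exists X, f; split=> // Y g aY; move: Y aY g.
apply: (add_sub (left_factor_additive f)) => g.
have [c cE] := hE g; have [k kE] := choice fE.
exists (lsum c k) => x; rewrite cE /=.
by apply: eq_bigr => i _; rewrite kE.
Qed.

(* The left approximation of [M] is the pushout of a left approximation
   [free n -> X] in [add U] along a presentation [free n -> M]. *)
Lemma Fac_functorially_finite U : functorially_finite (Fac U).
Proof.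
move=> M; split.
  have [X [f [aX fE]]] := right_add_approximation U M.
  have [I [e [i [es ii ie]]]] := image_obj f.
  exists I, i; split=> [|Y g [Z [p [aZ ps]]]]; first by exists X, e.
  apply: lift_inj ii _ => y; have [z <-] := ps y.
  by have [h hE] := fE Z (lcomp g p) aZ; exists (e (h z)); rewrite ie hE.
have [n [p ps]] := free_surj M.
have [X [f [aX fE]]] := left_add_approximation U (free n).
have [Q [q [qs qE]]] := fgquot_obj (submodule_image f (submodule_ker p)).
have [x px|g gE] := desc_surj (f := lcomp q f) ps.
  by apply/qE; exists x.
exists Q, g; split=> [|Y h [Z [r [aZ rs]]]]; first by exists X, q.
have [k kE] := free_lift (g := r) (f := lcomp h p) (fun v => rs _).
have [k' k'E] := fE Z k aZ.
have [x /qE[v pv <-]|l lE] := desc_surj (f := lcomp r k') qs.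
  by rewrite /= k'E kE /= pv linear0.
by exists l => x; have [v <-] := ps x; rewrite gE /= lE /= k'E kE.
Qed.

Lemma fitting_fixed X N (f : {linear X -> N}) (g : {linear X -> X}) n :
  (forall x, f (g x) = f x) -> forall x, f (iter n g x) = f x.
Proof. by move=> fg; elim: n => //= n IH x; rewrite fg IH. Qed.

Lemma right_minimal_approximation P M :
  exists X (f : {linear X -> M}),
    right_approximation (add P) f /\ right_minimal f.
Proof.
have [|X [[f [aX fX]] Xmin]] :=
  @min_cdim K A (fun X => exists f : {linear X -> M},
    right_approximation (add P) f).
  by have [X [f fX]] := right_add_approximation P M; exists X, f.
exists X, f; split=> // g fg.
have [n [I [i [e [r [n0 es ie ir]]]]]] := fitting g.
have aI : right_approximation (add P) (lcomp f i).
  split=> [|Y h aY]; first by apply: add_closed_retract aX; exists i, r.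
  have [k kE] := fX Y h aY; exists (lcomp e k) => y.
  by rewrite /= ie (fitting_fixed _ fg).
have is_ : surj i.
  by apply: inj_cdim_surj (can_inj ir) _; apply: Xmin; exists (lcomp f i).
apply: endo_surj_bij => y; have [z <-] := is_ y; have [x <-] := es z.
by exists (iter n.-1 g x); rewrite ie -iterS prednK.
Qed.

Lemma Ext_progenerator_add S P X : Ext_progenerator S P -> S X ->
  (forall Y, S Y -> Ext1_zero X Y) -> add P X.
Proof.
move=> [_ _ PS] SX XS; have [Y [P' [i [p [[SY _ _ se] aP]]]]] := PS X SX.
by have [s sK] := XS Y SY _ i p se; apply: add_closed_retract aP; exists s, p.
Qed.

Lemma Ext_progenerator_le S P Q :
  Ext_progenerator S P -> Ext_progenerator S Q -> subcat_le (add Q) (add P).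
Proof.
move=> gP [SQ QS _]; apply: add_le.
exact: Ext_progenerator_add gP SQ QS.
Qed.

Lemma add_short_exact_approximation P X M L (i : {linear L -> X})
    (f : {linear X -> M}) :
  Ext1_zero P L -> add P X -> short_exact i f -> right_approximation (add P) f.
Proof.
move=> PL aX se; split=> // Y g aY.
exact: Ext1_lift g se (add_Ext1 PL aY).
Qed.

(* An extension of [P] by [L], pushed out to [X], splits; correcting the
   resulting map to [X] by a factorization through [f] makes it land in [L]. *)
Lemma wakamatsu P X M L (i : {linear L -> X}) (f : {linear X -> M}) :
  right_approximation (add P) f -> Ext1_zero P X -> short_exact i f ->
  Ext1_zero P L.
Proof.
move=> [aX fX] PX se Z j q sej.
have [ii fi fs] := (short_exactP _ _).1 se.
have [ji qj qs] := (short_exactP _ _).1 sej.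
have [r rE] := Ext1_extend i sej PX.
have fi0 y : f (i y) = 0 by apply/fi; exists y.
have [z|t tE] := desc_surj (f := lcomp f r) qs.
  by move=> /qj[y <-]; rewrite /= rE.
have [h hE] := fX P t (add_self P).
have [z|k kE] := @lift_inj _ _ _ _ i (lsub r (lcomp h q)) ii.
  by apply/fi; rewrite /= linearB hE tE /= subrr.
have kj y : k (j y) = y.
  apply: ii; rewrite kE /= rE (_ : q (j y) = 0) ?linear0 ?addr0 //.
  by apply/qj; exists y.
have [z /qj[y <-]|s sE] := desc_surj (f := lsub (lid Z) (lcomp j k)) qs.
  by rewrite /= kj subrr.
exists s => p; have [z <-] := qs p; rewrite sE /= linearB.
by rewrite (_ : q (j _) = 0) ?subr0 //; apply/qj; exists (k z).
Qed.

(* For a left approximation [f : A -> T0] of minimal dimension and its cokernel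
   [T1], the sum [P = T0 + T1] works: if [L] is the kernel of a right
   approximation in [add P], then [Ext^1(T1, L) = 0], so every map [A -> L],
   which kills [ker f], extends to [T0 -> L], and [L] is in [Fac T0]. *)
Lemma torsion_class_progenerator T : torsion_class T -> functorially_finite T ->
  exists P, Ext_progenerator T P.
Proof.
move=> Tt Tf.
have [|T0 [[f [TT0 fT0]] Tmin]] :=
  @min_cdim K A (fun X => exists f : {linear free 1 -> X},
    left_approximation T f).
  by have [_ [X [f fX]]] := Tf (free 1); exists X, f.
have fmin (h : {linear T0 -> T0}) : (forall x, h (f x) = f x) -> bijective h.
  move=> hf; have [I [e [i [es ii ie]]]] := image_obj h.
  have TI : left_approximation T (lcomp e f).
    split=> [|Y g TY]; first exact: torsion_class_quotient es _.
    have [k kE] := fT0 Y g TY; exists (lcomp k i) => x.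
    by rewrite /= ie hf kE.
  have es' : injective e.
    by apply: surj_cdim_inj es _; apply: Tmin; exists (lcomp e f).
  by apply: endo_inj_bij => x y; rewrite -!ie => /ii/es'.
have [T1 [c [cs cE]]] := fgquot_obj (submodule_range f).
have TT1 : T T1 by apply: torsion_class_quotient cs _.
have Ext0 Y : T Y -> Ext1_zero T0 Y.
  move=> TY; apply: Ext1_zeroP => X i p se.
  have [ii ip ps] := (short_exactP _ _).1 se.
  have [l lE] := free_lift (g := p) (f := f) (fun v => ps _).
  have [h hE] := fT0 X l (torsion_class_ext Tt se TY TT0).
  exists h; apply: (fmin (lcomp p h)) => x /=.
  by rewrite hE lE.
have Ext1 Y : T Y -> Ext1_zero T1 Y.
  move=> TY X i p se.
  have [ii ip ps] := (short_exactP _ _).1 se.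
  have [s sE] := Ext1_lift c se (Ext0 Y TY).
  have cf x : c (f x) = 0 by apply/cE; exists x.
  have [x|y yE] := @lift_inj _ _ _ _ i (lcomp s f) ii.
    by apply/ip; rewrite /= sE.
  have [y' y'E] := fT0 Y y TY.
  have [x /cE[v _ <-]|t tE] := desc_surj (f := lsub s (lcomp i y')) cs.
    by rewrite /= y'E yE subrr.
  exists t => z; have [x <-] := cs z; rewrite tE /= linearB sE.
  by rewrite (_ : p (i _) = 0) ?subr0 //; apply/ip; exists (y' x).
pose P := dsum T0 T1.
have [Tz TD Tr] := torsion_class_additive Tt TT0.
have TP : T P by apply: TD.
have PT Y : T Y -> Ext1_zero P Y.
  move=> TY; have [_ ED _] := Ext1_additive Y.
  by apply: ED; [apply: Ext0|apply: Ext1].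
exists P; split=> // M TM.
have [X [g gX]] := right_add_approximation P M.
have TX : T X.
  by case: gX => aX _; apply: (add_sub (torsion_class_additive Tt TT0)) aX.
have gs : surj g.
  move=> m.
  have [h hE] := fT0 M (free_map (fun _ : 'I_1 => m)) TM.
  have [k kE] := gX.2 T0 h (add_retract (retract_dsuml T0 T1)).
  exists (k (f (delta_mx 0 0 : 'rV[A^c]_1))).
  by rewrite kE hE free_map_delta.
have [L [i se]] := ker_short_exact gs.
have [ii gi _] := (short_exactP _ _).1 se.
have PL : Ext1_zero P L := wakamatsu gX (PT X TX) se.
exists L, X, i, g; split; last by case: gX.
split=> //.
have FL l : exists k : {linear T0 -> L},
    k (f (delta_mx 0 0 : 'rV[A^c]_1)) = l.
  have [I [e [j [es ji je]]]] := image_obj f.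
  have seI : short_exact j c.
    apply/short_exactP; split=> // x; rewrite cE; split=> [[y _ <-]|[z <-]].
      by exists (e y); rewrite je.
    by have [y <-] := es z; exists y; rewrite ?je.
  pose a := free_map (fun _ : 'I_1 => l).
  have [b bE] := fT0 X (lcomp i a) TX.
  have [x ex|a' a'E] := desc_surj (f := a) es.
    by apply: (ker_inj ii); rewrite -[LHS]/(lcomp i a x) -bE -je ex !linear0.
  have T1L : Ext1_zero T1 L.
    have [_ _ Er] := Ext1_additive L.
    exact: Er (retract_dsumr T0 T1) PL.
  have [k kE] := Ext1_extend a' seI T1L.
  by exists k; rewrite -je kE a'E free_map_delta.
have [n [g' g'P]] := fgmod_fg L.
have [k kE] := choice (fun i => FL (g' i)).
have [Y [q [aY qE]]] := hom_list k.
have TY : T Y by apply: (add_sub (torsion_class_additive Tt TT0)) aY.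
apply: (torsion_class_quotient (p := q) Tt _ TY) => l.
have [d ->] := g'P l; have [k' k'E] := choice qE.
exists (\sum_i d i *: k' i (f (delta_mx 0 0 : 'rV[A^c]_1))).
by rewrite linear_sum; apply: eq_bigr => j _; rewrite linearZ k'E kE.
Qed.

Lemma basic_progenerator T : torsion_class T -> functorially_finite T ->
  exists P, basic_Ext_progenerator T P.
Proof.
move=> Tt Tf; have [P [TP PT PS]] := torsion_class_progenerator Tt Tf.
have [|V [Vb VE]] := @basic_part K A P (fun=> True); first by [].
have aV : add P V by have [] := (VE V).1 (add_self V).
have aP : add V P by apply/VE; split=> //; apply: add_self.
exists V; split=> //; split=> [|X TX|X TX].
- exact: add_sub (torsion_class_additive Tt TP) TP _ aV.
- exact: add_Ext1 (PT X TX) aV.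
- have [Y [P' [i [p [cf aP']]]]] := PS X TX.
  by exists Y, P', i, p; split=> //; apply: add_le aP _ aP'.
Qed.

End Approximations.

(** * The Auslander-Reiten translation *)

Section Tau.
Variables (K : closedFieldType) (A : falgType K).
Implicit Types (I M N P Q U V W X Y Z : fgmod A).

Lemma projective_retract P Q : retract Q P -> projective P -> projective Q.
Proof.
move=> [i [p ip]] Pp M N g f gs; have [h hE] := Pp M N g (lcomp f p) gs.
by exists (lcomp h i) => x; rewrite /= hE /= ip.
Qed.

Lemma free_projective n : projective (free A n).
Proof. by move=> M N g f /surjP gs; apply: free_lift => v; apply: gs. Qed.

Lemma projective_lift P M N (g : {linear M -> N}) (f : {linear P -> N}) :
  projective P -> surj g -> exists h : {linear P -> M}, forall x, g (h x) = f x.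
Proof. by move=> Pp gs; apply: Pp; apply/surjP. Qed.

Lemma regdual_inj (P : lmodType A^c) (xi eta : regdual P) :
  (forall x, xi x = eta x) -> xi = eta.
Proof. by move=> H; apply: val_inj; apply: funext. Qed.

Lemma regdual_lin (P : lmodType A^c) (xi : regdual P) (a : A^c) x y :
  xi (a *: x + y) = ((xi x : A) * (a : A) + (xi y : A) : A).
Proof. by have /asboolP := regdualP xi; apply. Qed.

Lemma regdual_act_subproof (P X : lmodType A^c) (x : X) (xi : regdual P) :
  linear (fun p => ((xi p : A) : A^c) *: x).
Proof.
move=> a u v; rewrite regdual_lin.
rewrite -[X in X *: x]/((a : A^c) * ((xi u : A) : A^c) + ((xi v : A) : A^c)).
by rewrite scalerDl scalerA.
Qed.

(* [p |-> x xi(p)], the image of [x (x) xi] under the natural map from the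
   tensor product of [X] and [Hom(P, A)] to [Hom(P, X)], which is bijective for
   projective [P]. *)
Definition regdual_act (P X : lmodType A^c) (x : X) (xi : regdual P) :
  {linear P -> X} := mklin (regdual_act_subproof x xi).

Lemma dual_basis P : projective P -> exists n (e : 'I_n -> P)
  (xi : 'I_n -> regdual P), forall p, p = \sum_i ((xi i p : A) : A^c) *: e i.
Proof.
move=> Pp; have [n [f fs]] := free_surj P.
have [h hE] := projective_lift (lid P) Pp fs.
have xiP i : (fun p => (h p : 'rV[A^c]_n) 0 i : A^o) \in @regdual_pred K A P.
  by apply/asboolP => a x y; rewrite linearP !mxE.
exists n, (fun i => f (delta_mx 0 i : 'rV[A^c]_n)), (fun i => RegDual (xiP i)).
by move=> p; rewrite -[LHS]hE (free_mapE f).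
Qed.

Lemma regdual_sum (P : lmodType A^c) (J : Type) (r : seq J)
    (F : J -> regdual P) p :
  (\sum_(i <- r) F i) p = \sum_(i <- r) (F i p : A) :> A.
Proof. by elim/big_rec2: _ => // i y1 y2 _ <-. Qed.

Lemma regdual_lsum (P : lmodType A^c) (J : Type) (r : seq J) (c : J -> A^c)
    (F : J -> P) (xi : regdual P) :
  xi (\sum_(i <- r) c i *: F i) = \sum_(i <- r) (xi (F i) : A) * (c i : A) :> A.
Proof.
elim/big_rec2: _ => [|i y1 y2 _ <-]; last exact: regdual_lin.
have := regdual_lin xi 1 0 0; rewrite scaler0 addr0 => /eqP.
by rewrite mulr1 -subr_eq0 opprD addrA subrr add0r oppr_eq0 => /eqP.
Qed.

Lemma dual_basis_regdual P n (e : 'I_n -> P) (xi : 'I_n -> regdual P) :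
  (forall p, p = \sum_i ((xi i p : A) : A^c) *: e i) ->
  forall eta : regdual P, eta = \sum_i (eta (e i) : A) *: xi i.
Proof.
move=> eE eta; apply: regdual_inj => p.
rewrite {1}(eE p).
transitivity (\sum_i (eta (e i) : A) * (xi i p : A) : A).
  exact: (regdual_lsum _ (fun i => xi i p : A) e eta).
apply: esym; exact: regdual_sum.
Qed.

Section HomTau.
Variables (P1 P0 : fgmod A) (p1 : {linear P1 -> P0}) (L : lmodType A).
Variable q : {linear regdual P1 -> L}.
Hypotheses (P1p : projective P1) (P0p : projective P0).
Hypothesis q_ker :
  forall xi, q xi = 0 <-> exists eta, regdual_map p1 eta = xi.
Hypothesis q_surj : surj q.

Lemma kdual_lin (phi : kdual L) k x y :
  phi (k%:A *: x + y) = k * phi x + phi y.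
Proof. by have /asboolP := kdualP phi; apply. Qed.

Lemma kdualD (phi : kdual L) x y : phi (x + y) = phi x + phi y.
Proof. by have := kdual_lin phi 1 x y; rewrite !scale1r mul1r. Qed.

Lemma kdual0 (phi : kdual L) : phi 0 = 0.
Proof.
have /eqP := kdualD phi 0 0.
by rewrite addr0 -subr_eq0 opprD addrA subrr add0r oppr_eq0 => /eqP.
Qed.

Lemma kdual_sum (phi : kdual L) (J : Type) (r : seq J) (F : J -> L) :
  phi (\sum_(i <- r) F i) = \sum_(i <- r) phi (F i).
Proof. exact: (big_morph _ (kdualD phi) (kdual0 phi)). Qed.

Lemma Hom_kdual_zero X (t : {linear X -> kdual L}) :
  (forall g : {linear P1 -> X},
     exists h : {linear P0 -> X}, forall x, h (p1 x) = g x) ->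
  forall x, t x = 0.
Proof.
move=> gh x; have [n [e [xi eE]]] := dual_basis P0p.
have [m [f [zeta fE]]] := dual_basis P1p.
apply: val_inj; apply: funext => l; have [eta <-] := q_surj l.
rewrite -[LHS]/(t x (q eta)) -[RHS]/(0 : K).
have tE (a : A) y z : t ((a : A^c) *: y) z = t y (a *: z) by rewrite linearZ.
have [h hE] := gh (regdual_act x eta).
have tsum (J : Type) (r : seq J) (F : J -> X) z :
    t (\sum_(i <- r) F i) z = \sum_(i <- r) t (F i) z.
  by rewrite linear_sum; elim/big_rec2: _ => // i y1 y2 _ <-.
rewrite [in LHS](dual_basis_regdual fE eta) (linear_sum q) kdual_sum.
transitivity (\sum_j \sum_i
    t (h (e i)) (q ((regdual_map p1 (xi i) (f j) : A) *: zeta j))).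
  apply: eq_bigr => j _; rewrite linearZ /= -tE.
  rewrite -[_ *: x]/(regdual_act x eta (f j)) -hE {1}(eE (p1 (f j))).
  rewrite linear_sum tsum; apply: eq_bigr => i _.
  by rewrite linearZ /= tE linearZ.
rewrite exchange_big big1 // => i _.
rewrite -kdual_sum -linear_sum -(dual_basis_regdual fE (regdual_map p1 (xi i))).
by rewrite (_ : q _ = 0) ?kdual0 //; apply/q_ker; exists (xi i).
Qed.

Lemma Hom_kdual_zero_factor X :
  (forall (t : {linear X -> kdual L}) x, t x = 0) ->
  forall g : {linear P1 -> X},
     exists h : {linear P0 -> X}, forall x, h (p1 x) = g x.
Proof.
move=> t0 g; apply: contrapT => gN.
pose F (f : {linear P1 -> X}) :=
  exists h : {linear P0 -> X}, forall x, h (p1 x) = f x.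
have F0 (h : {linear P1 -> X}) : (forall x, h x = 0) -> F h.
  by move=> h0; exists (lzero _ _) => x; rewrite h0.
have FD k (f f' h : {linear P1 -> X}) : F f -> F f' ->
    (forall x, h x = ksc k (f x) + f' x) -> F h.
  move=> [u uE] [v vE] hE; exists (ladd (lksc k u) v) => x.
  by rewrite hE /= uE vE.
have [lam [lamD lam0 lamg]] := hom_separate F0 FD gN.
have [s sE] := choice q_surj.
have act_q x xi eta : q xi = q eta ->
    lam (regdual_act x xi) = lam (regdual_act x eta).
  move=> xe; have [d dE] : exists d, regdual_map p1 d = xi - eta.
    by apply/q_ker; rewrite linearB xe subrr.
  have -> : xi = regdual_map p1 d + eta by rewrite dE subrK.
  rewrite (lamD 1 (regdual_act x (regdual_map p1 d)) (regdual_act x eta)).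
    by rewrite lam0 ?mulr0 ?add0r //; exists (regdual_act x d).
  by move=> p; rewrite ksc1 -scalerDl.
have act_scale x (a : A) xi p :
    regdual_act x (a *: xi) p = regdual_act ((a : A^c) *: x) xi p.
  by rewrite /= scalerA.
have act_ksc x k xi p :
    regdual_act x (k%:A *: xi) p = ksc k (regdual_act x xi p).
  by rewrite act_scale /= -ksc_scale.
have thP x : (fun l => lam (regdual_act x (s l))) \in @kdual_pred K A L.
  apply/asboolP => k l l'.
  rewrite (act_q _ _ (k%:A *: s l + s l')); last by rewrite linearP !sE.
  apply: lamD => p; rewrite -act_ksc.
  by rewrite -scalerDl.
pose th x : kdual L := KDual (thP x).
have th_lin : linear th.
  move=> a x y; apply: val_inj; apply: funext => l.
  rewrite -[RHS]/(lam (regdual_act x (s ((a : A) *: l)))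
                  + lam (regdual_act y (s l))).
  rewrite (act_q x _ ((a : A) *: s l)); last by rewrite linearZ !sE.
  rewrite -[lam (regdual_act x ((a : A) *: s l))]mul1r; apply: lamD => p.
  by rewrite ksc1 act_scale /= scalerDr.
have lam_act x xi : lam (regdual_act x xi) = 0.
  rewrite (act_q x _ (s (q xi))) ?sE //.
  by rewrite -[LHS]/(mklin th_lin x (q xi)) t0.
have [m [f [zeta fE]]] := dual_basis P1p.
have lam_sum n (G : 'I_n -> {linear P1 -> X}) (h : {linear P1 -> X}) :
    (forall i, lam (G i) = 0) -> (forall x, h x = \sum_i G i x) -> lam h = 0.
  elim: n G h => [|n IH] G h G0 hE.
    by apply/lam0/F0 => x; rewrite hE big_ord0.
  have hE' x : h x = ksc 1 (G ord0 x)
     + lsub h (G ord0) x by rewrite ksc1 /= addrC subrK.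
  rewrite (lamD _ _ _ _ hE') G0 mulr0 add0r.
  apply: (IH (fun i => G (lift ord0 i))) => [i //|x].
  by rewrite /= hE big_ord_recl addrC addKr.
apply: lamg; apply: (lam_sum _ (fun j => regdual_act (g (f j)) (zeta j))) => //.
move=> x; rewrite {1}(fE x) linear_sum.
by apply: eq_bigr => j _; rewrite linearZ.
Qed.

End HomTau.

Definition factors_through P1 P0 (p1 : {linear P1 -> P0}) X :=
  forall g : {linear P1 -> X},
    exists h : {linear P0 -> X}, forall x, h (p1 x) = g x.

Lemma factors_Ext1 M P1 P0 (p1 : {linear P1 -> P0}) (p0 : {linear P0 -> M})
    X Y :
  projective P1 -> projective P0 -> surj p0 ->
  (forall x, p0 x = 0 <-> exists y, p1 y = x) ->
  factors_through p1 X -> Fac X Y -> Ext1_zero M Y.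
Proof.
move=> P1p P0p p0s p0k fX [X' [r [aX rs]]] Z i p se.
have [ii ip ps] := (short_exactP _ _).1 se.
have [l lE] := projective_lift p0 P0p ps.
have [x|y yE] := lift_inj (f := lcomp l p1) ii.
  by apply/ip; rewrite /= lE; apply/p0k; exists x.
have [y' y'E] := projective_lift y P1p rs.
have fX' : factors_through p1 X'.
  by apply: (add_sub (left_factor_additive p1)) aX.
have [h hE] := fX' y'.
have [x /p0k[v <-]|s sE] := desc_surj (f := lsub l (lcomp i (lcomp r h))) p0s.
  by rewrite /= hE y'E yE subrr.
exists s => m; have [x <-] := p0s m; rewrite sE /= linearB lE.
by rewrite (_ : p (i _) = 0) ?subr0 //; apply/ip; exists (r (h x)).
Qed.

(* Subtracting from [g] maps that factor through [p1] moves its image into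
   [g (ker p1)]. If the dimension of the image is minimal, then
   [g (ker p1) = g P1], so [ker p1 + ker g = P1] and [g = 0] because [p1] is
   essential. *)
Lemma Ext1_factors M P1 P0 (p1 : {linear P1 -> P0}) (p0 : {linear P0 -> M}) X :
  projective P0 -> surj p0 -> projective_cover p1 (kernel p0) ->
  (forall Y, Fac X Y -> Ext1_zero M Y) -> factors_through p1 X.
Proof.
move=> P0p p0s [_ p1r ess] MX g.
have p0k x : p0 x = 0 <-> exists y, p1 y = x.
  rewrite -[p0 x = 0]/(kernel p0 x) -p1r.
  by split=> [[y _ <-]|[y <-]]; exists y.
pose D I := exists (g' : {linear P1 -> X}) (e : {linear P1 -> I})
    (i : {linear I -> X}) (h : {linear P0 -> X}),
  [/\ surj e, injective i, forall x, i (e x) = g' x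
    & forall x, g x = g' x + h (p1 x)].
have [|I [[g' [e [i [h [es ii ie gE]]]]] Imin]] := @min_cdim K A D.
  have [I [e [i [es ii ie]]]] := image_obj g.
  exists I, g, e, i, (lzero _ _); split=> // x /=.
  by rewrite addr0.
have [Y [q [qs qE]]] := fgquot_obj (submodule_image g' (submodule_ker p1)).
have [W [e1 [j [e1s ji je1]]]] := image_obj p1.
have [x ex|w wE] := desc_surj (f := lcomp q g') e1s.
  by apply/qE; exists x => //; rewrite /kernel /= -je1 ex linear0.
have FY : Fac X Y by exists X, q; split=> //; apply: add_self.
have se : short_exact j p0.
  apply/short_exactP; split=> // x; rewrite p0k; split=> [[y <-]|[y <-]].
    by exists (e1 y).
  by have [z <-] := e1s y; exists z.
have [t tE] := Ext1_extend w se (MX Y FY).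
have [h' h'E] := projective_lift t P0p qs.
pose g'' := lsub g' (lcomp h' p1).
have g''k x : exists2 y, p1 y = 0 & g' y = g'' x.
  have /qE[y] : q (g'' x) = 0.
    by rewrite /= linearB h'E -je1 tE wE subrr.
  by exists y.
have [I2 [e2 [i2 [e2s i2i i2e]]]] := image_obj g''.
have [z|k kE] := lift_inj (f := i2) ii.
  have [x <-] := e2s z; have [y _ yx] := g''k x.
  by exists (e y); rewrite ie yx i2e.
have ks : surj k.
  apply: inj_cdim_surj => [x y kxy|]; first by apply: i2i; rewrite -!kE kxy.
  apply: Imin; exists g'', e2, i2, (ladd h h'); split=> // x /=.
  by rewrite gE addrACA addNr addr0.
have g'k x : exists2 y, p1 y = 0 & g' y = g' x.
  have [z zE] := ks (e x); have [v vE] := e2s z.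
  have [y y0 yv] := g''k v; exists y => //.
  by rewrite yv -i2e vE -kE zE ie.
have [N [n [ni nE]]] := ker_obj g'.
have ns : surj n.
  apply/surjP; apply: ess; rewrite -p1r; apply/seteqP; split=> x [y _ <-].
    by exists (n y).
  have [z z0 zy] := g'k y.
  have /nE[u uE] : g' (y - z) = 0 by rewrite linearB zy subrr.
  by exists u => //; rewrite uE linearB z0 subr0.
exists h => x; rewrite gE (_ : g' x = 0) ?add0r //.
by apply/nE; apply: ns.
Qed.

Lemma projective_cover_exists M S : submodule S ->
  exists P (f : {linear P -> M}), projective_cover f S.
Proof.
move=> Ss; have [N [i [ii iS]]] := fgsub_obj Ss.
pose D P := projective P /\ exists f : {linear P -> M}, range f = S.
have [|P [[Pp [f fS]] Pmin]] := @min_cdim K A D.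
  have [n [p ps]] := free_surj N; exists (free A n); split.
    exact: free_projective.
  exists (lcomp i p); apply/seteqP; split=> x.
    by case=> y _ <-; apply/iS; exists (p y).
  by move=> /iS[y <-]; have [z <-] := ps y; exists z.
exists P, f; split=> // X g gS.
have iE x : exists y, i y = f x by apply/iS; rewrite -fS; exists x.
have [f' f'E] := lift_inj ii iE.
have f's : surj (lcomp f' g).
  move=> y; have [x _ xE] : [set f (g x) | x in setT] (i y).
    by rewrite gS; apply/iS; exists y.
  by exists x; apply: ii; rewrite f'E.
have [h hE] := projective_lift f' Pp f's.
have fgh x : f (lcomp g h x) = f x by rewrite -[RHS]f'E -hE /= f'E.
have [n [I [j [e [r [n0 es je jr]]]]]] := fitting (lcomp g h).
have js : surj j.
  apply: inj_cdim_surj (can_inj jr) _; apply: Pmin; split.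
    by apply: projective_retract Pp; exists j, r.
  exists (lcomp f j); apply/seteqP; split=> x.
    by case=> y _ <-; rewrite -fS; exists (j y).
  rewrite -fS => -[y _ <-]; exists (e y) => //.
  by rewrite /= je fitting_fixed.
apply/surjP => y; have [z <-] := js y; have [x <-] := es z.
by exists (h (iter n.-1 (lcomp g h) x)); rewrite je -[in RHS](prednK n0) iterS.
Qed.

Lemma regdual_map_linear (P Q : lmodType A^c) (f : {linear P -> Q}) :
  linear (regdual_map f).
Proof. by move=> a x y; apply: regdual_inj. Qed.

Lemma kdual_fg P (L : lmodType A) (q : {linear regdual P -> L}) :
  projective P -> surj q -> finitely_generated (kdual L).
Proof.
move=> Pp qs; have [n [e [xi eE]]] := dual_basis Pp.
pose b := vbasis {:A}; pose d := \dim {:A}.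
pose ev (phi : kdual L) : 'M[K]_(n, d) :=
  \matrix_(i, j) phi ((b`_j : A) *: q (xi i)).
have ev_inj phi psi : ev phi = ev psi -> phi = psi.
  move=> ev_eq; apply: val_inj; apply: funext => l; have [eta <-] := qs l.
  rewrite -[LHS]/(phi (q eta)) -[RHS]/(psi (q eta)).
  rewrite (dual_basis_regdual eE eta) (linear_sum q) !kdual_sum.
  apply: eq_bigr => i _; rewrite linearZ /=.
  have aE : (eta (e i) : A) = \sum_j coord b j (eta (e i) : A) *: b`_j.
    by apply: coord_basis; [exact: vbasisP|exact: memvf].
  rewrite aE scaler_suml !kdual_sum; apply: eq_bigr => j _.
  set k := coord _ _ _.
  have kE (th : kdual L) : th ((k *: b`_j : A) *: q (xi i)) =
      k * th ((b`_j : A) *: q (xi i)).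
    rewrite -mulr_algl -scalerA.
    by rewrite -[X in th X]addr0 kdual_lin kdual0 addr0.
  by rewrite !kE; have /matrixP/(_ i j) := ev_eq; rewrite !mxE => ->.
have evD k phi psi : ev ((k%:A : A^c) *: phi + psi) = k *: ev phi + ev psi.
  apply/matrixP => i j; rewrite !mxE.
  rewrite -[LHS]/(phi ((k%:A : A) *: _) + psi _).
  by rewrite -[X in phi X]addr0 kdual_lin kdual0 addr0.
have [] := @row_span K (n * d) [set v | exists phi, mxvec (ev phi) = v].
- exists 0; rewrite -[RHS](linear0 mxvec); congr mxvec.
  by apply/matrixP => i j; rewrite !mxE.
- move=> a u v [phi <-] [psi <-]; exists ((a%:A : A^c) *: phi + psi).
  by rewrite evD linearP.
move=> B BP.
have /choice[g gE] i : exists phi, mxvec (ev phi) = row i B by apply/BP/row_sub.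
have ev0 : ev 0 = 0 by apply/matrixP => i j; rewrite !mxE.
exists _, g => phi.
have /submxP[D DE] : (mxvec (ev phi) <= B)%MS by apply/BP; exists phi.
exists (fun i => (D 0 i)%:A : A^c); apply: ev_inj; apply: (can_inj mxvecK).
rewrite DE mulmx_sum_row.
have -> : ev (\sum_i ((D 0 i)%:A : A^c) *: g i) = \sum_i D 0 i *: ev (g i).
  elim/big_rec2: _ => [//|i y1 y2 _ <-]; exact: evD.
by rewrite linear_sum; apply: eq_bigr => i _; rewrite linearZ /= gE.
Qed.

Lemma tau_rigid_Ext1 U : tau_rigid U -> forall Y, Fac U Y -> Ext1_zero U Y.
Proof.
move=> [N [[L [[P1 [P0 [p1 [p0 [q [[c0 c1] qr qs]]]]]] iso]] H0]] Y.
have [P0p p0r _] := c0; have [P1p p1r _] := c1.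
have p0k x : p0 x = 0 <-> exists y, p1 y = x.
  rewrite -[p0 x = 0]/(kernel p0 x) -p1r.
  by split=> [[y _ <-]|[y <-]]; exists y.
apply: (factors_Ext1 P1p P0p _ p0k); first exact/surjP.
apply: (@Hom_kdual_zero_factor P1 P0 p1 L q P1p).
- move=> xi; rewrite -[q xi = 0]/(kernel q xi) -qr.
  by split=> [[y _ <-]|[y <-]]; exists y.
- exact/surjP.
- move=> t x; have /isomorphicP[u [v [uv vu]]] := iso.
  by rewrite -[LHS]vu -[v (t x)]/(lcomp v t x) H0 linear0.
Qed.

Lemma Ext1_tau_rigid U : (forall Y, Fac U Y -> Ext1_zero U Y) -> tau_rigid U.
Proof.
move=> Ur.
have [P0 [p0 c0]] := projective_cover_exists (submodule_range (lid U)).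
have rid : range (lid U) = setT by apply/surjP => x; exists x.
rewrite rid in c0.
have [P1 [p1 c1]] := projective_cover_exists (submodule_ker p0).
have [P0p p0r _] := c0; have [P1p p1r _] := c1.
have rs := submodule_range (mklin (regdual_map_linear p1)).
have [L [q [qs qE]]] := quot_obj rs.
pose N := FgMod (kdual_fg P1p qs).
exists N; split.
  exists L; split; last exact: isomorphic_refl.
  exists P1, P0, p1, p0, q; split=> //; last exact/surjP.
  by apply/seteqP; split=> x; [move=> ?; apply/qE|move=> /qE].
move=> t.
apply: (@Hom_kdual_zero P1 P0 p1 L q P1p P0p _ qs U t).
  by move=> xi; rewrite qE; split=> [[y _ <-]|[y <-]]; exists y.
by apply: (Ext1_factors P0p _ c1); first exact/surjP.
Qed.

End Tau.

(** * The bijection *)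

Section Bijection.
Variables (K : closedFieldType) (A : falgType K).
Implicit Types (L M N P Q U V W X Y Z : fgmod A).
Implicit Types S T C E : subcat A.

Lemma iso_add U V : isomorphic U V -> subcat_eq (add U) (add V).
Proof.
by move=> iso M; split; apply: add_le; apply: add_retract;
  [apply: iso_retract|apply: iso_retract_sym].
Qed.

Lemma cok1_le U V : subcat_le (add U) (add V) -> subcat_le (cok1 U) (cok1 V).
Proof.
move=> UV M [U1 [U0 [f [g [a1 a0 fg gs]]]]].
by exists U1, U0, f, g; split=> //; apply: UV.
Qed.

Lemma cok1_two_fold U :
  (forall Y, Fac U Y -> Ext1_zero U Y) -> two_fold_torsion_class (cok1 U).
Proof.
move=> Ur; exists (Fac U); first exact: Fac_torsion_class.
exact: cok1_torsion_class_in.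
Qed.

Lemma add_cok1 U : (forall Y, Fac U Y -> Ext1_zero U Y) ->
  subcat_le (add U) (cok1 U).
Proof.
move=> Ur; apply: add_sub (cok1_self U).
exact: two_fold_additive (cok1_two_fold Ur) (cok1_self U).
Qed.

Lemma Fac_progenerator U P : (forall Y, Fac U Y -> Ext1_zero U Y) ->
  Ext_progenerator (Fac U) P -> add P U.
Proof.
move=> Ur gP; apply: Ext_progenerator_add gP _ Ur.
exact/add_Fac/add_self.
Qed.

Lemma cok1_fL2tors_star U : (forall Y, Fac U Y -> Ext1_zero U Y) ->
  fL2tors_star (cok1 U).
Proof.
move=> Ur; split; first exact: cok1_two_fold.
  by rewrite T1_cok1 //; apply: Fac_functorially_finite.
move=> P [_]; rewrite T1_cok1 // => gP M X f.
move=> /cok1P[U0 [L [i [g [a0 FL se]]]]] [aX fX] fmin.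
have aPU0 : add P U0 by apply: add_le a0; apply: Fac_progenerator.
have PL : Ext1_zero P L by case: gP => _ PS _; apply: PS.
have [_ gU0] := add_short_exact_approximation PL aPU0 se.
have [h hE] := gU0 X f aX; have [k kE] := fX U0 g aPU0.
apply: add_cok1 => //; apply: add_closed_retract a0.
apply: (bij_retract (f := h) (g := k)).
by apply: (fmin (lcomp k h)) => x; rewrite /= kE hE.
Qed.

Lemma T1_nonempty C : functorially_finite (T1 C) -> exists M, C M.
Proof.
move=> /(_ zero_fg)[[X [f [TX _]]] _]; apply: contrapT => C0.
apply: (TX (fun=> False)) => [|M CM]; last by apply: C0; exists M.
by split.
Qed.

Lemma fL2tors_star_progenerator C : fL2tors_star C ->
  exists P, basic_Ext_progenerator (T1 C) P.
Proof.
by move=> [_ Tf _]; apply: basic_progenerator Tf; apply: T1_torsion_class.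
Qed.

Lemma Phi_isoclass C P U : basic_Ext_progenerator (T1 C) P -> basic U ->
  subcat_eq (add U) (fun M => C M /\ add P M) ->
  subcat_eq (Phi C) (isoclass U).
Proof.
move=> bP Ub UE V; split=> [[Vb [Q bQ VE]]|UV].
  apply: basic_add_unique => // M; rewrite UE VE.
  have [PQ QP] : (add Q M -> add P M) /\ (add P M -> add Q M).
    have [[_ gP] [_ gQ]] := (bP, bQ).
    by split; [exact: Ext_progenerator_le gP gQ _|
               exact: Ext_progenerator_le gQ gP _].
  tauto.
split; first by apply: basic_retract Ub; apply: iso_retract_sym.
by exists P => // M; rewrite -UE; apply: iff_sym; apply: iso_add.
Qed.

Lemma intersection_Ext1 C P U : basic_Ext_progenerator (T1 C) P ->
  subcat_eq (add U) (fun M => C M /\ add P M) ->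
  [/\ C U, add P U & forall Y, Fac U Y -> Ext1_zero U Y].
Proof.
move=> [_ [TP PT _]] UE; have [CU aU] := (UE U).1 (add_self U).
split=> // Y FY; apply: add_Ext1 aU; apply: PT.
by apply: torsion_class_Fac FY; [apply: T1_torsion_class|apply: T1_sub].
Qed.

Lemma Phi_exists C : fL2tors_star C ->
  exists U, [/\ basic U, tau_rigid U & subcat_eq (Phi C) (isoclass U)].
Proof.
move=> /[dup]/fL2tors_star_progenerator[P bP] [C2 Tf _].
have [M CM] := T1_nonempty Tf.
have [U [Ub UE]] := basic_part P (two_fold_additive C2 CM).
have UE' : subcat_eq (add U) (fun M => C M /\ add P M).
  by move=> X; rewrite UE; split=> -[].
exists U; split=> //; last exact: Phi_isoclass bP Ub UE'.
by apply: Ext1_tau_rigid; case: (intersection_Ext1 bP UE').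
Qed.

Lemma Phi_cok1 U : basic U -> (forall Y, Fac U Y -> Ext1_zero U Y) ->
  subcat_eq (Phi (cok1 U)) (isoclass U).
Proof.
move=> Ub Ur; have [P bP] := fL2tors_star_progenerator (cok1_fL2tors_star Ur).
apply: (Phi_isoclass bP) => // M.
have gP : Ext_progenerator (Fac U) P by rewrite -T1_cok1 //; case: bP.
split=> [aM|[/cok1P[U0 [L [i [g [a0 FL se]]]]] aM]].
  split; first exact: add_cok1.
  by apply: add_le aM; apply: Fac_progenerator.
have [_ PS _] := gP.
have [s sK] := add_Ext1 (PS L FL) aM se.
by apply: add_closed_retract a0; exists s, g.
Qed.

Lemma cok1_Phi C U : fL2tors_star C -> Phi C U -> subcat_eq (cok1 U) C.
Proof.
move=> [C2 Tf Cstar] [Ub [P bP UE]].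
have [CU aU Ur] := intersection_Ext1 bP UE.
have [_ [TP PT PS]] := bP.
have Tt := T1_torsion_class C.
have [_ TD Tr] := torsion_class_additive Tt TP.
have key M : C M -> exists X L (i : {linear L -> X}) (f : {linear X -> M}),
    [/\ add U X, T1 C L & short_exact i f].
  move=> CM; have [X [f [fX fmin]]] := right_minimal_approximation P M.
  have [Y [P' [i [p [[TY _ _ se] aP']]]]] := PS M (T1_sub CM).
  have [_ pP'] := add_short_exact_approximation (PT Y TY) aP' se.
  have [aX fX'] := fX.
  have [h hE] := pP' X f aX; have [k kE] := fX' P' p aP'.
  have fs : surj f.
    move=> m; have [_ _ ps] := (short_exactP _ _).1 se.
    by have [x <-] := ps m; exists (k x).
  have khb : bijective (lcomp k h).
    by apply: fmin => x; rewrite /= kE hE.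
  have [g [gK Kg]] := lin_inv (bij_inj khb) (bij_surj khb).
  have [L [j sej]] := ker_short_exact fs.
  exists X, L, j, f; split=> //.
    by apply/UE; split=> //; apply: Cstar bP M X f CM fX fmin.
  have [ji fj _] := (short_exactP _ _).1 sej.
  have [ii pi _] := (short_exactP _ _).1 se.
  have [y|u uE] := lift_inj (f := lcomp k i) ji.
    by apply/fj; rewrite /= kE; apply/pi; exists y.
  apply: (torsion_class_quotient (p := u)) TY => // l.
  have fg x : f (g x) = f x.
    by rewrite -[in RHS](Kg x) /= kE hE.
  have /pi[y yE] : p (h (g (j l))) = 0.
    by rewrite hE fg; apply/fj; exists l.
  by exists y; apply: ji; rewrite uE /= yE; apply: Kg.
have TF : subcat_le (T1 C) (Fac U).
  move=> M TM; apply: TM; first exact: Fac_torsion_class.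
  move=> N CN; have [X [L [i [f [aX _ /short_exactP[_ _ fs]]]]]] := key N CN.
  by exists X, f.
move=> M; split=> [/cok1P[U0 [L [i [g [a0 FL se]]]]]|CM]; last first.
  have [X [L [i [f [aX TL se]]]]] := key M CM.
  by apply/cok1P; exists X, L, i, f; split=> //; apply: TF.
have [E Et Ct] := C2; have [_ CE _] := Ct.
have FE Y : Fac U Y -> E Y by apply: torsion_class_Fac => //; apply: CE.
have CU0 : C U0 by apply: (add_sub (two_fold_additive C2 CU) CU).
apply: (torsion_class_in_quotient Ct se) CU0; first exact: FE.
apply: FE; exists U0, g; split=> //; by case/short_exactP: se.
Qed.

End Bijection.

Theorem theorem1p8 (K : closedFieldType) (A : falgType K) :
  (* U |-> cok1 U is well defined *)
  (forall U : fgmod A, basic U -> tau_rigid U -> fL2tors_star (cok1 U)) /\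
  (forall U V : fgmod A, isomorphic U V -> subcat_eq (cok1 U) (cok1 V)) /\
  (* C |-> Phi C is well defined *)
  (forall C : subcat A, fL2tors_star C ->
     exists U : fgmod A,
       [/\ basic U, tau_rigid U & subcat_eq (Phi C) (isoclass U)]) /\
  (* the two maps are mutually inverse *)
  (forall U : fgmod A, basic U -> tau_rigid U ->
     subcat_eq (Phi (cok1 U)) (isoclass U)) /\
  (forall (C : subcat A) (U : fgmod A),
     fL2tors_star C -> Phi C U -> subcat_eq (cok1 U) C).
Proof.
split=> [U _ Ur|].
  exact/cok1_fL2tors_star/tau_rigid_Ext1.
split=> [U V UV M|].
  by split; apply: cok1_le => X; case: (iso_add UV X).
split; first exact: Phi_exists.
split=> [U Ub Ur|]; last exact: cok1_Phi.
exact/Phi_cok1/tau_rigid_Ext1.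
Qed.
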